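(* Consider Contaminated Best Arm Identification (CBAI) against an oblivious, prescient, or malicious adversary. There exists a positive constant $B$ such that for any number of arms $k\ge2$, any confidence level $\delta\in(0,\tfrac{3}{20})$, any suboptimality level $\alpha\in(0,\tfrac16)$, any contamination level $\varepsilon\in(0,\tfrac{1}{15})$, any regularity level $\bar t\in(0,\tfrac{1}{10})$, and any effective gaps $\{\tilde\Delta_i\}_{i\in[k]\setminus\{i^*\}}\subset(0,\tfrac13)$, there exists a CBAI instance with $F_1,\dots,F_k\in\mathcal{F}_{\bar t,B}$ (having these effective gaps) for which any $(\alpha,\delta)$-PAC algorithm has expected sample complexity $$\mathbb{E}[T]=\Omega\left(\sum_{i\in[k]\setminus\{i^*\}}\frac{1}{\max(\tilde\Delta_i,\alpha)^2}\log\frac1\delta\right),$$ where $i^*=\arg\max_{i\in[k]}m_1(F_i)$ is the optimal arm.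
   Context: Notation. Distributions are on $\mathbb{R}$ and identified with cdfs. $Q_{L,F}(p)=\inf\{x:F(x)\ge p\}$, $Q_{R,F}(p)=\inf\{x:F(x)>p\}$. $m_1(F)$ is the (unique) median of $F$ and $m_2(F)$ is the median of $|X-m_1(F)|$, $X\sim F$. For $\bar t\in(0,\tfrac12)$, $B>0$, $\mathcal{F}_{\bar t,B}$ is the family of distributions $F$ with a unique median and $|F(x_1)-F(x_2)|\ge\frac{1}{B\,m_2(F)}|x_1-x_2|$ for all $x_1,x_2\in[Q_{L,F}(\tfrac12-\bar t),Q_{R,F}(\tfrac12+\bar t)]$. CBAI. There are $k\ge2$ arms with unknown true distributions $F_1,\dots,F_k$ and a contamination level $\varepsilon\in(0,\tfrac12)$. At each iteration $t$ an algorithm picks an arm $I_t\in[k]$ and observes $X_{I_t,t}$, where $X_{i,t}=(1-D_{i,t})Y_{i,t}+D_{i,t}Z_{i,t}$, $Y_{i,t}\sim F_i$, $D_{i,t}\sim\mathrm{Ber}(\varepsilon)$, and $Z_{i,t}$ is a contamination chosen by the adversary. After $T$ iterations ($T$ a possibly random, almost surely finite stopping time, the sample complexity) it outputs an arm $\hat I$. Adversaries: - Oblivious: for each $i$ the triples $(Y_{i,t},D_{i,t},Z_{i,t})_{t\ge1}$ are independent across $t$; $Y_{i,t}$ and $D_{i,t}$ are independent. - Prescient: for each $i$ the pairs $(Y_{i,t},D_{i,t})_{t\ge1}$ are independent across $t$, $Y_{i,t}$ and $D_{i,t}$ are independent, and each $Z_{i,t}$ may depend on all of $\{Y_{j,s},D_{j,s},Z_{j,s}\}_{j\in[k],s\ge1}$.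 - Malicious: as prescient, but $Y_{i,t}$ and $D_{i,t}$ need not be independent of each other. A CBAI instance comprises the true distributions and the adversary's contaminations. The unavoidable uncertainty of arm $i$ is $U_i=B\,m_2(F_i)\frac{\varepsilon}{2(1-\varepsilon)}$ for oblivious and prescient adversaries and $U_i=B\,m_2(F_i)\,\varepsilon$ for malicious ones. The effective gap of $i\ne i^*$ is $\tilde\Delta_i=(m_1(F_{i^*})-U_{i^*})-(m_1(F_i)+U_i)$ (and the same formula defines $\tilde\Delta_{i^*}$). An algorithm is $(\alpha,\delta)$-PAC if $\mathbb{P}(\tilde\Delta_{\hat I}\le\alpha)\ge1-\delta$, i.e. $\mathbb{P}\big(m_1(F_{\hat I})\ge\max_im_1(F_i)-(\alpha+U_{i^*}+U_{\hat I})\big)\ge1-\delta$. $\Omega$ hides a universal positive constant. *)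

(* Defs.v *)
From HB Require Import structures.
From mathcomp Require Import all_boot all_order all_algebra.
From mathcomp Require Import all_classical all_reals all_analysis.

Set Implicit Arguments.
Unset Strict Implicit.
Unset Printing Implicit Defensive.

Import Order.TTheory GRing.Theory Num.Theory.

Local Open Scope classical_set_scope.
Local Open Scope ring_scope.

Section quantiles.
Context {R : realType}.

(* The infima are the mathematical ones for 0 < p < 1, which is the only range
   in which these quantiles are used: [inf] of an empty or unbounded set is a
   default value. *)
Definition QL (G : R -> R) (p : R) : R := inf [set x | p <= G x].
Definition QR (G : R -> R) (p : R) : R := inf [set x | p < G x].

Definition law := probability (measurableTypeR R) R.

Definition cdf_of (F : law) (x : R) : R := fine (F `]-oo, x]%classic).

Definition unique_median (F : law) : Prop :=
  QL (cdf_of F) 2^-1 = QR (cdf_of F) 2^-1.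

Definition m1 (F : law) : R := QL (cdf_of F) 2^-1.

(* The cdf of |X - m1 F| for X ~ F. *)
Definition absdev_cdf (F : law) (x : R) : R :=
  fine (F [set y | `|y - m1 F| <= x]).

(* Nothing in [in_family] makes the median of |X - m1 F| unique; as for [m1],
   the left one is taken. *)
Definition m2 (F : law) : R := QL (absdev_cdf F) 2^-1.

(* [0 < m2 F] is implicit in the division by [B * m2 F], and has to be stated
   because x / 0 = 0 here. *)
Definition in_family (tbar B : R) (F : law) : Prop :=
  [/\ unique_median F, 0 < m2 F &
      forall x1 x2 : R,
        QL (cdf_of F) (2^-1 - tbar) <= x1 <= QR (cdf_of F) (2^-1 + tbar) ->
        QL (cdf_of F) (2^-1 - tbar) <= x2 <= QR (cdf_of F) (2^-1 + tbar) ->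
        (B * m2 F)^-1 * `|x1 - x2| <= `|cdf_of F x1 - cdf_of F x2| ].

End quantiles.
Arguments law : clear implicits.

Section independence.
Context {R : realType} d (T : measurableType d) (P : probability T R).

Definition independent2 d1 d2 (S1 : measurableType d1) (S2 : measurableType d2)
    (X : T -> S1) (Y : T -> S2) : Prop :=
  forall (A : set S1) (B : set S2), measurable A -> measurable B ->
    P (X @^-1` A `&` Y @^-1` B) = (P (X @^-1` A) * P (Y @^-1` B))%E.

(* Initial segments of indices suffice: [A t] may be the whole space. *)
Definition independent_seq d' (S : measurableType d') (W : nat -> T -> S) :
    Prop :=
  forall (n : nat) (A : nat -> set S), (forall t, measurable (A t)) ->
    P [set w | forall t, (t < n)%N -> A t (W t w)] =
      (\big[*%E/1%E]_(t < n) P (W t @^-1` A t))%E.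

End independence.

Inductive adversary := Oblivious | Prescient | Malicious.

(* Iterations are numbered from 0. *)
Record cbai_instance (R : realType) (k : nat) := CBAIInstance {
  inst_disp : measure_display ;
  inst_space : measurableType inst_disp ;
  inst_prob : probability inst_space R ;
  arm : 'I_k -> law R ;
  Y_ : 'I_k -> nat -> {RV inst_prob >-> R} ;
  D_ : 'I_k -> nat -> {RV inst_prob >-> bool} ;
  Z_ : 'I_k -> nat -> {RV inst_prob >-> R} }.

Section instances.
Context {R : realType} {k : nat}.
Implicit Types (I : cbai_instance R k) (adv : adversary).

Definition X_ I (i : 'I_k) (t : nat) (w : inst_space I) : R :=
  (1 - (D_ I i t w)%:R) * Y_ I i t w + (D_ I i t w)%:R * Z_ I i t w.

(* Nothing is assumed across arms. For the prescient and malicious adversaries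
   the joint law of the whole family [Z_] with ([Y_], [D_]) is arbitrary. *)
Definition legal adv (eps : R) I : Prop :=
  (forall (i : 'I_k) (t : nat),
     (forall A : set R, measurable A ->
        distribution (inst_prob I) (Y_ I i t) A = arm I i A)
     /\ (forall A : set bool,
        distribution (inst_prob I) (D_ I i t) A = bernoulli_prob eps A))
  /\
  match adv with
  | Oblivious => forall i : 'I_k,
      independent_seq (inst_prob I)
        (fun t w => (Y_ I i t w, D_ I i t w, Z_ I i t w)) /\
      forall t, independent2 (inst_prob I) (Y_ I i t) (D_ I i t)
  | Prescient => forall i : 'I_k,
      independent_seq (inst_prob I) (fun t w => (Y_ I i t w, D_ I i t w)) /\
      forall t, independent2 (inst_prob I) (Y_ I i t) (D_ I i t)
  | Malicious => forall i : 'I_k,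
      independent_seq (inst_prob I) (fun t w => (Y_ I i t w, D_ I i t w))
  end.

Definition admissible adv (eps tbar B : R) I : Prop :=
  legal adv eps I /\ forall i, in_family tbar B (arm I i).

Definition uncertainty adv (eps B : R) (F : law R) : R :=
  match adv with
  | Oblivious | Prescient => B * m2 F * (eps / (2 * (1 - eps)))
  | Malicious => B * m2 F * eps
  end.

Definition optimal_arm I (istar : 'I_k) : Prop :=
  forall j : 'I_k, j != istar -> m1 (arm I j) < m1 (arm I istar).

Definition effective_gap adv (eps B : R) I (istar i : 'I_k) : R :=
  (m1 (arm I istar) - uncertainty adv eps B (arm I istar))
  - (m1 (arm I i) + uncertainty adv eps B (arm I i)).

End instances.

(* A randomised sequential algorithm. Its private randomness is a point of
   [seed], independent of the instance; its decisions after [t] iterations are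
   functions of that seed and of the [t] values observed so far (the arms pulled
   so far are themselves determined by these). *)
Record algorithm (R : realType) (k : nat) := Algorithm {
  seed_disp : measure_display ;
  seed : measurableType seed_disp ;
  seed_prob : probability seed R ;
  pull : forall t : nat, seed * t.-tuple R -> 'I_k ;
  halt : forall t : nat, seed * t.-tuple R -> bool ;
  output : forall t : nat, seed * t.-tuple R -> 'I_k ;
  pull_measurable : forall (t : nat) (i : 'I_k),
    measurable (pull (t := t) @^-1` [set i]) ;
  halt_measurable : forall t : nat, measurable (halt (t := t) @^-1` [set true]) ;
  output_measurable : forall (t : nat) (i : 'I_k),
    measurable (output (t := t) @^-1` [set i]) }.

Section runs.
Context {R : realType} {k : nat} (alg : algorithm R k) (I : cbai_instance R k).

Definition run_space := (inst_space I * seed alg)%type.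

Definition run_prob : set run_space -> \bar R :=
  (inst_prob I \x seed_prob alg)%E.

(* The first [t] observations; past the stopping time they are fictitious. *)
Fixpoint observed (z : run_space) (t : nat) : t.-tuple R :=
  match t return t.-tuple R with
  | 0 => [tuple]
  | t'.+1 =>
      [tuple of rcons (observed z t')
                      (X_ (pull (z.2, observed z t')) t' z.1)]
  end.

Definition stops_at (t : nat) (z : run_space) : Prop :=
  halt (z.2, observed z t) /\
  forall s : nat, (s < t)%N -> ~~ halt (z.2, observed z s).

(* Equal to +oo when the algorithm never stops. *)
Definition sample_complexity (z : run_space) : \bar R :=
  ereal_inf [set t%:R%:E | t in [set t : nat | stops_at t z]].

Definition expected_sample_complexity : \bar R :=
  (\int[(inst_prob I \x seed_prob alg)%E]_z sample_complexity z)%E.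

Definition as_finite : Prop :=
  run_prob [set z | exists t, stops_at t z] = 1%E.

Definition outputs (i : 'I_k) (z : run_space) : Prop :=
  exists2 t : nat, stops_at t z & output (z.2, observed z t) = i.

End runs.

(* The guarantee is required on every admissible instance with a unique optimal
   arm, the effective gaps being ambiguous otherwise. *)
Definition PAC (R : realType) (k : nat) (adv : adversary)
    (eps tbar B alpha delta : R) (alg : algorithm R k) : Prop :=
  forall I : cbai_instance R k, admissible adv eps tbar B I ->
    as_finite alg I /\
    forall istar : 'I_k, optimal_arm I istar ->
      ((1 - delta)%:E <=
       run_prob [set z : run_space alg I | exists2 i : 'I_k, outputs i z &
                   (effective_gap adv eps B I istar i <= alpha)%R])%E.

(* Main.v *)
Require Import Defs.
From HB Require Import structures.
From mathcomp Require Import all_boot all_order all_algebra.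
From mathcomp Require Import all_classical all_reals all_analysis.
From mathcomp Require Import measurable_realfun ring lra zify.
Import Order.TTheory GRing.Theory Num.Theory.
Import numFieldNormedType.Exports.
Local Open Scope classical_set_scope.
Local Open Scope ring_scope.

Set Implicit Arguments.
Unset Strict Implicit.
Unset Printing Implicit Defensive.

(* Clean arms have atoms at -4 and 4 and density 1/8 on [-3, 3]; then m2 = 2
   whatever the median, and with B = 4 the slope condition is an equality, so
   that contamination can shift the observed median by exactly U in either
   direction. The observed law depends only on its own median, not on the
   direction of the contamination. Hence raising the observed median of a
   single arm j above all the others gives an instance with the same observed
   laws except for arm j, in which only j may be output.

   Let Lam be the log-likelihood ratio of the two instances up to the stopping
   time, N the number of pulls of j, and Phi x = e^x - 1 - x. Then
   E[Phi Lam] <= K E[N], K bounding a Kullback-Leibler divergence, and on the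
   event that an arm other than j is output
   Phi Lam + (1/a - 1) e^Lam >= ln (1/a). Taking expectations and changing
   measure, K E[N] >= ln (1/a) P(not j) - (1/a - 1) P'(not j), with
   P'(not j) <= delta and a = 2 delta. In the original instance P(not j) is
   at least about 1/2 for all arms but at most one, for which the optimal arm,
   whose K is the smallest, is substituted in the sum of the E[N]. *)

(** * Splitting a uniform variable into two independent ones *)

(** The expected log-likelihood ratio at the stopping time would call for its integrability and an
    optional stopping identity. [Phi] avoids both: it is nonnegative, and since the log-likelihood
    ratio g of one observation satisfies E[e^g] = 1, the mean of Phi (L + g) is Phi L plus the
    Kullback-Leibler divergence. The bound on E[Phi Lam] is thus an induction over a finite horizon
    with nonnegative integrals only. Almost sure stopping enters once, to choose a horizon by which
    the run has stopped with probability at least 49/50. The choice a = 2 delta makes the error term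
    (1/a - 1) delta smaller than 1/2, while 49/100 ln (1/a) stays above 1/2 for delta < 3/20. Fresh
    data at each iteration come from a single uniform variable on [0, 1], whose base-4 digits are
    split into two independent uniform variables, repeatedly. One space then carries all hard
    instances, which differ only by their observation functions, and a change of measure is an
    identity between two integrals over that space. *)

Lemma measure_lt_unique (R : realType)
    (P Q : {measure set (measurableTypeR R) -> \bar R}) :
  (P setT < +oo)%E ->
  (forall a : R, P `]-oo, a[%classic = Q `]-oo, a[%classic) ->
  forall A, measurable A -> P A = Q A.
Proof.
move=> Pfin PQ A mA.
refine (@measure_unique _ R (measurableTypeR R) (@RGenInftyO.G R)
  (fun n : nat => `]-oo, n%:R[%classic) _ _ _ _ P Q _ _ A mA) => //.
- exact: RGenInftyO.measurableE.
- move=> _ _ [a ->] [b ->]; exists (Num.min a b).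
  by apply/seteqP; split => x /=; rewrite !in_itv/= lt_min => /andP.
- by move=> n; exists n%:R.
- apply/seteqP; split => // x _.
  by exists (Num.trunc x).+1 => //=; rewrite in_itv/= truncnS_gt.
- by move=> _ [a ->].
- move=> n; apply: le_lt_trans Pfin.
  by apply: le_measure => //; rewrite inE//; exact: measurable_itv.
Qed.

Section split.
Variable R : realType.

Definition unif : probability (measurableTypeR R) R := uniform_prob (@ltr01 R).

Lemma unifE (A : set R) : measurable A ->
  unif A = lebesgue_measure (A `&` `[0, 1]%classic).
Proof.
move=> mA; rewrite /unif/= /uniform_prob integral_uniform_pdf.
have mA1 : measurable (A `&` `[0, 1]) by exact: measurableI.
under eq_integral.
  move=> x; rewrite inE /= => -[_]; rewrite in_itv/= => x01.
  rewrite /uniform_pdf x01 subr0 invr1; over.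
by rewrite integral_cst// mul1e.
Qed.

Lemma unif_itv (b1 b2 : bool) (x y : R) : 0 <= x -> x <= y -> y <= 1 ->
  unif [set` Interval (BSide b1 x) (BSide b2 y)] = (y - x)%:E.
Proof.
move=> x0 xy y1; rewrite unifE; last exact: measurable_itv.
rewrite setIidl; last first.
  move=> z /=; rewrite !in_itv/= => /andP[xz zy]; apply/andP; split.
    by case: b1 xz => /=; lra.
  by case: b2 zy => /=; lra.
rewrite lebesgue_measure_itv/= lte_fin; case: ltP => // yx.
by rewrite (_ : y = x) ?subrr//; apply/eqP; rewrite eq_le xy yx.
Qed.

Lemma unif_lt (a : R) : 0 <= a <= 1 -> unif `]-oo, a[%classic = a%:E.
Proof.
move=> /andP[a0 a1]; rewrite -[in RHS](subr0 a) -(unif_itv true true)//.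
rewrite !unifE; [|exact: measurable_itv..].
congr (lebesgue_measure _).
by apply/seteqP; split => x /=; rewrite !in_itv/=; lra.
Qed.

Lemma unif_lt0 (a : R) : a <= 0 -> unif `]-oo, a[%classic = 0%:E.
Proof.
move=> a0; rewrite unifE// (_ : _ `&` _ = set0) ?measure0//.
by apply/seteqP; split => x //=; rewrite !in_itv/= => -[xa /andP[x0 _]]; lra.
Qed.

Lemma unif_lt1 (a : R) : 1 <= a -> unif `]-oo, a[%classic = 1%:E.
Proof.
move=> a1; apply/eqP; rewrite eq_le probability_le1//=.
rewrite -(@unif_lt 1) ?ler01 ?lexx//; apply: le_measure.
- by rewrite inE; exact: measurable_itv.
- by rewrite inE; exact: measurable_itv.
- by move=> x /=; rewrite !in_itv/= => /lt_le_trans; exact.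
Qed.

(* [deint b n t] reads off the high ([b]) or low bits of the last [n] base-4
   digits of [t]. *)
Fixpoint deint (b : bool) (n t : nat) : nat :=
  if n is n'.+1 then ((deint b n' (t %/ 4)).*2 + (if b then t %/ 2 else t) %% 2)%N
  else 0%N.

Lemma deint_lt b n t : (deint b n t < 2 ^ n)%N.
Proof.
elim: n t => [//|n IH] t /=; have := IH (t %/ 4)%N.
have : ((if b then t %/ 2 else t) %% 2 < 2)%N by rewrite ltn_mod.
by rewrite expnS; lia.
Qed.

(** Interleaving the bits of [p] and [q] inverts [deint]: the last base-4 digit is
    [2 * (p %% 2) + q %% 2]. Consequently a dyadic square of side [2^-n] has as preimage a single
    interval of length [4^-n], which is what makes the two halves jointly uniform. *)
Lemma deint_bij n p q : (p < 2 ^ n)%N -> (q < 2 ^ n)%N ->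
  exists2 t0, (t0 < 4 ^ n)%N & forall t, (t < 4 ^ n)%N ->
    (deint true n t = p /\ deint false n t = q) <-> t = t0.
Proof.
elim: n p q => [|n IH] p q; first by exists 0%N => // t; case: t => //=; lia.
rewrite !expnS => pn qn.
have [||t1 t1n t1P] := IH (p %/ 2)%N (q %/ 2)%N; [lia|lia|].
exists (4 * t1 + 2 * (p %% 2) + q %% 2)%N; first by lia.
move=> t tn /=; have tn4 : (t %/ 4 < 4 ^ n)%N by lia.
have [h1 h2] := t1P _ tn4; split.
  move=> [tp tq].
  have : (t %/ 4)%N = t1 by apply: h1; split; lia.
  lia.
move=> tE; have : (t %/ 4)%N = t1 by lia.
by move=> /h2 [-> ->]; lia.
Qed.

End split.

Section digits.
Variable R : realType.
Local Notation U := (@unif R).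

Let J : set R := `[0, 1[%classic.

Let mJ : measurable J. Proof. exact: measurable_itv. Qed.

(** The bound [digits n x < 4 ^ n] holds on [[0, 1[] but fails at 1, so cells are measured after
    restricting to this set of full measure. *)
Lemma unif_setI01 (A : set R) : measurable A -> U (J `&` A) = U A.
Proof.
move=> mA.
have U1 : U (~` J) = 0%E.
  have := probability_setC U mJ; rewrite unif_itv ?lexx//.
  by rewrite subr0 subee.
rewrite [in RHS](measureDI U mA mJ) setIC -[LHS]add0e; congr (_ + _)%E.
apply/esym/eqP; rewrite eq_le measure_ge0 andbT -U1 setDE.
apply: le_measure; rewrite ?inE; [|exact: measurableC|exact: subIsetr].
by apply: measurableI => //; exact: measurableC.
Qed.

Definition digits n (x : R) : nat := Num.trunc (4 ^+ n * x).

Lemma digits_div n x : (digits n.+1 x %/ 4)%N = digits n x.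
Proof.
(* [Num.trunc] of a negative number is 0, so both sides vanish there. *)
rewrite /digits; have [x0|x0] := leP 0 x; last first.
  have Z m : Num.trunc ((4 : R) ^+ m * x) = 0%N.
    have : (Num.trunc ((4 : R) ^+ m * x) <= 0)%N; last lia.
    rewrite truncn_le_nat (@le_lt_trans _ _ 0)// nmulr_lle0//.
  by rewrite !Z.
apply/esym/truncn_def.
have /truncn_itv : 0 <= 4 ^+ n.+1 * x by rewrite mulr_ge0// exprn_ge0.
set t := Num.trunc _; rewrite exprS.
rewrite {1 2}(divn_eq t 4) -addn1 !natrD natrM.
have : (t %% 4 < 4)%N by rewrite ltn_mod.
rewrite -(ltr_nat R) => r4; have r0 : 0 <= (t %% 4)%:R :> R by [].
have : (t %% 4)%:R <= 3 :> R by rewrite ler_nat -ltnS ltn_mod.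
move: r4 r0; set r := (t %% 4)%:R; rewrite -[(_ %/ _).+1]addn1 natrD.
by lra.
Qed.

Lemma measurable_digits n (g : nat -> R) :
  measurable_fun setT (fun x : measurableTypeR R => g (digits n x)).
Proof.
move=> _ A mA; rewrite setTI.
rewrite (_ : _ @^-1` _ =
  \bigcup_(t in [set t | A (g t)]) [set x | digits n x = t]); last first.
  by apply/seteqP; split=> [x /= Ax|x [t /= At tE]]; [exists (digits n x)|rewrite tE].
apply: bigcup_measurable => t _.
rewrite /digits; have p0 : 0 < 4 ^+ n :> R by rewrite exprn_gt0.
have mle (s : nat) :
    measurable [set x : measurableTypeR R | (Num.trunc (4 ^+ n * x) <= s)%N].
  rewrite (_ : [set _ | _] = `]-oo, s.+1%:R / 4 ^+ n[%classic).
    exact: measurable_itv.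
  apply/seteqP; split => x /=; rewrite in_itv/= truncn_le_nat;
    by rewrite ltr_pdivlMr// mulrC.
case: t => [|t].
  rewrite (_ : [set _ | _] = [set x | (Num.trunc (4 ^+ n * x) <= 0)%N])//.
  by apply/seteqP; split => x /=; move: (Num.trunc _) => m; lia.
rewrite (_ : [set _ | _] = [set x | (Num.trunc (4 ^+ n * x) <= t.+1)%N] `\`
  [set x | (Num.trunc (4 ^+ n * x) <= t)%N]); first exact: measurableD.
by apply/seteqP; split => x /=; move: (Num.trunc _) => m; lia.
Qed.

Definition half_ b n (x : R) : R := (deint b n (digits n x))%:R / 2 ^+ n.

Definition half b (x : R) : R := limn (half_ b ^~ x).

Lemma half_nd b x : nondecreasing_seq (half_ b ^~ x).
Proof.
apply/nondecreasing_seqP => n; rewrite /half_ exprS.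
rewrite /= digits_div invfM mulrA ler_pM2r ?invr_gt0 ?exprn_gt0//.
by rewrite natrD -mul2n natrM ler_pdivlMr// mulrC lerDl.
Qed.

Lemma half_lt1 b n x : half_ b n x + (2 ^+ n)^-1 <= 1.
Proof.
rewrite /half_ -[X in _ + X]mul1r -mulrDl ler_pdivrMr ?exprn_gt0// mul1r.
by rewrite -natrX natr1 ler_nat; exact: deint_lt.
Qed.

(** With [half_nd] this gives nested intervals of length [2^-n] around the limit, hence the explicit
    error in [half_ge] and [half_le]. *)
Lemma half_ni b x : nonincreasing_seq (fun n => half_ b n x + (2 ^+ n)^-1).
Proof.
apply/nonincreasing_seqP => n; rewrite /half_ exprS.
rewrite -[X in _ + X <= _]mul1r -[X in _ <= _ + X]mul1r -!mulrDl.
rewrite /= digits_div invfM mulrA ler_pM2r ?invr_gt0 ?exprn_gt0//.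
rewrite ler_pdivrMr// !natr1 -natrM ler_nat.
have : ((if b then digits n.+1 x %/ 2 else digits n.+1 x) %% 2 < 2)%N.
  by rewrite ltn_mod.
by lia.
Qed.

Lemma half_cvg b x : cvgn (half_ b ^~ x).
Proof.
apply: nondecreasing_is_cvgn; first exact: half_nd.
exists 1 => _ [n _ <-]; apply: le_trans (half_lt1 b n x).
by rewrite lerDl invr_ge0 exprn_ge0.
Qed.

Lemma half_ge b n x : half_ b n x <= half b x.
Proof.
by apply: (nondecreasing_cvgn_le (@half_nd b x)); exact: half_cvg.
Qed.

Lemma half_le b n x : half b x <= half_ b n x + (2 ^+ n)^-1.
Proof.
apply: (@limr_le _ _ _ _ _ (half_ b ^~ x)).
  exact: half_cvg.
near=> m; apply: (@le_trans _ _ (half_ b m x + (2 ^+ m)^-1)).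
  by rewrite lerDl invr_ge0 exprn_ge0.
by apply: half_ni; near: m; exact: nbhs_infty_ge.
Unshelve. all: by end_near.
Qed.

Lemma half_ge0 b x : 0 <= half b x.
Proof.
by apply: le_trans (half_ge b 0 x); rewrite /half_ mulr_ge0 ?invr_ge0 ?exprn_ge0.
Qed.

Lemma half_le1 b x : half b x <= 1.
Proof. exact: le_trans (half_le b 0 x) (half_lt1 b 0 x). Qed.

Lemma measurable_half b :
  measurable_fun setT (half b : measurableTypeR R -> measurableTypeR R).
Proof.
apply: (@measurable_fun_cvg _ _ _ _ (half_ b)).
  by move=> n; exact: (@measurable_digits n (fun t => (deint b n t)%:R / 2 ^+ n)).
by move=> x _; exact: half_cvg.
Qed.

Let cell n i j : set R :=
  [set x | deint true n (digits n x) = i /\ deint false n (digits n x) = j].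

Let strip n i q : set R :=
  [set x | deint true n (digits n x) = i /\ (deint false n (digits n x) < q)%N].

Let box n p q : set R :=
  [set x | (deint true n (digits n x) < p)%N /\
           (deint false n (digits n x) < q)%N].

Let measurable_digit_set n (Q : nat -> Prop) :
  measurable ([set x | Q (digits n x)] : set (measurableTypeR R)).
Proof.
have := @measurable_digits n (fun t => if `[< Q t >] then 1 else 0).
move=> /(_ measurableT [set 1]) /(_ (measurable_set1 _)); rewrite setTI.
rewrite (_ : _ @^-1` _ = [set x | Q (digits n x)])//.
apply/seteqP; split => x /=; first by case: asboolP => // _ /esym/eqP; rewrite oner_eq0.
by case: asboolP.
Qed.

Let unif_cell n i j : (i < 2 ^ n)%N -> (j < 2 ^ n)%N ->
  U (cell n i j) = ((4 ^+ n)^-1)%:E.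
Proof.
move=> ilt jlt; rewrite -unif_setI01; last first.
  exact: (@measurable_digit_set n (fun t => deint true n t = i /\ deint false n t = j)).
have [t0 t0lt t0P] := deint_bij ilt jlt.
have p0 : 0 < 4 ^+ n :> R by rewrite exprn_gt0.
rewrite (_ : _ `&` _ = `[t0%:R / 4 ^+ n, t0.+1%:R / 4 ^+ n[%classic).
  rewrite unif_itv; first by rewrite -mulrBl -natr1 addrC addKr mul1r.
  - by rewrite divr_ge0// ltW.
  - by rewrite ler_pM2r ?invr_gt0// ler_nat.
  - by rewrite ler_pdivrMr// mul1r -natrX ler_nat.
have dlt x : J x -> (digits n x < 4 ^ n)%N.
  rewrite /J/= in_itv/= => /andP[x0 x1].
  rewrite truncn_lt_nat; last by rewrite mulr_ge0// ltW.
  by rewrite natrX gtr_pMr.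
apply/seteqP; split => x /=.
  move=> [Jx] /(t0P _ (dlt x Jx)) dE; rewrite in_itv/=.
  move: Jx; rewrite /J/= in_itv/= => /andP[x0 x1].
  have : 0 <= 4 ^+ n * x by rewrite mulr_ge0// ltW.
  move=> /truncn_itv; rewrite -/(digits n x) dE => /andP[h1 h2].
  by rewrite ler_pdivrMr// ltr_pdivlMr// mulrC h1.
rewrite in_itv/= ler_pdivrMr// ltr_pdivlMr// (mulrC x) => h.
have Jx : J x.
  rewrite /J/= in_itv/=; move: h => /andP[h1 h2]; apply/andP; split.
    by rewrite -(pmulr_rge0 _ p0) (le_trans _ h1).
  rewrite -(ltr_pM2l p0) (lt_le_trans h2)// mulr1 -natrX ler_nat//.
split => //; apply/(t0P _ (dlt x Jx)).
exact: truncn_def.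
Qed.

Let cell_big n i j : ~ ((i < 2 ^ n)%N /\ (j < 2 ^ n)%N) -> cell n i j = set0.
Proof.
move=> ij; apply/seteqP; split => // x [/= xi xj]; apply: ij.
by rewrite -xi -xj; split; exact: deint_lt.
Qed.

Let unif_cell_le n i j : (U (cell n i j) <= ((4 ^+ n)^-1)%:E)%E.
Proof.
have [[? ?]|/cell_big ->] := pselect ((i < 2 ^ n)%N /\ (j < 2 ^ n)%N).
  by rewrite unif_cell.
by rewrite measure0 lee_fin invr_ge0 exprn_ge0.
Qed.

Let stripS n i q : U (strip n i q.+1) = (U (strip n i q) + U (cell n i q))%E.
Proof.
rewrite -measureU.
- congr (U _); apply/seteqP; split => x;
    rewrite /strip /cell /box /= ltnS (leq_eqVlt (deint _ _ _)).
    by move=> [-> /orP[/eqP ->|->]]; [right|left].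
  by move=> [[-> ->]|[-> ->]]; rewrite ?eqxx ?orbT.
- exact: (@measurable_digit_set n
    (fun t => deint true n t = i /\ (deint false n t < q)%N)).
- exact: (@measurable_digit_set n
    (fun t => deint true n t = i /\ deint false n t = q)).
- by apply/seteqP; split => x //= [[_ +] [_ xq]]; rewrite xq ltnn.
Qed.

Let boxS n p q : U (box n p.+1 q) = (U (box n p q) + U (strip n p q))%E.
Proof.
rewrite -measureU.
- congr (U _); apply/seteqP; split => x;
    rewrite /strip /cell /box /= ltnS (leq_eqVlt (deint _ _ _)).
    by move=> [/orP[/eqP ->|->] ->]; [right|left].
  by move=> [[-> ->]|[-> ->]]; rewrite ?eqxx ?orbT.
- exact: (@measurable_digit_set n
    (fun t => (deint true n t < p)%N /\ (deint false n t < q)%N)).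
- exact: (@measurable_digit_set n
    (fun t => deint true n t = p /\ (deint false n t < q)%N)).
- by apply/seteqP; split => x //= [[+ _] [xp _]]; rewrite xp ltnn.
Qed.

Let strip0 n i : U (strip n i 0) = 0%E.
Proof. by rewrite (_ : strip _ _ _ = set0) ?measure0//; apply/seteqP; split => x []. Qed.

Let box0 n q : U (box n 0 q) = 0%E.
Proof. by rewrite (_ : box _ _ _ = set0) ?measure0//; apply/seteqP; split => x []. Qed.

Let unif_box_le n p q : (U (box n p q) <= (p%:R * q%:R / 4 ^+ n)%:E)%E.
Proof.
have S i : (U (strip n i q) <= (q%:R / 4 ^+ n)%:E)%E.
  elim: q => [|q IH]; first by rewrite strip0 mul0r.
  rewrite stripS -natr1 mulrDl mul1r EFinD; exact: leeD.
elim: p => [|p IH]; first by rewrite box0 !mul0r.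
by rewrite boxS -natr1 !mulrDl mul1r EFinD; exact: leeD.
Qed.

Let unif_box n p q : (p <= 2 ^ n)%N -> (q <= 2 ^ n)%N ->
  U (box n p q) = (p%:R * q%:R / 4 ^+ n)%:E.
Proof.
move=> pn qn.
have S i : (i < 2 ^ n)%N -> U (strip n i q) = (q%:R / 4 ^+ n)%:E.
  move=> ilt; elim: q qn => [|q IH] qn; first by rewrite strip0 mul0r.
  by rewrite stripS -natr1 mulrDl mul1r EFinD IH 1?ltnW// unif_cell.
elim: p pn => [|p IH] pn; first by rewrite box0 !mul0r.
by rewrite boxS -natr1 !mulrDl mul1r EFinD IH 1?ltnW// S.
Qed.

Let event (a b : R) : set R := half true @^-1` `]-oo, a[ `&` half false @^-1` `]-oo, b[.

Let measurable_event a b : measurable (event a b).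
Proof.
by apply: measurableI; rewrite -[X in measurable X]setTI;
  apply: measurable_half => //; exact: measurable_itv.
Qed.

(** At level [n] the set is covered by a box of [tr a] by [tr b] cells. The conditions on [S] are
    non-strict so that the bound also serves once [a] and [b] are capped at 1, a value the halves
    may reach. *)
Let unif_event_upper n (a b : R) (S : set (measurableTypeR R)) :
  measurable S -> 0 <= a -> 0 <= b ->
  (forall x, S x -> half true x <= a /\ half false x <= b) ->
  (U S <= ((a + (2 ^+ n)^-1) * (b + (2 ^+ n)^-1))%:E)%E.
Proof.
move=> mS a0 b0 Sab; pose tr (c : R) := (Num.trunc (2 ^+ n * c)).+1.
have p0 : 0 < 2 ^+ n :> R by rewrite exprn_gt0.
have sub c b' x : 0 <= c -> half b' x <= c -> (deint b' n (digits n x) < tr c)%N.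
  move=> c0 xc; rewrite /tr ltnS truncn_ge_nat; last by rewrite mulr_ge0// ltW.
  rewrite mulrC -ler_pdivrMr//; exact: le_trans (half_ge b' n x) xc.
have le1 c : 0 <= c -> (tr c)%:R <= 2 ^+ n * (c + (2 ^+ n)^-1).
  move=> c0; rewrite mulrDr mulfV ?gt_eqF// /tr -natr1 lerD2r.
  by rewrite truncn_le mulr_ge0// ltW.
apply: (@le_trans _ _ (U (box n (tr a) (tr b)))).
  apply: le_measure; rewrite ?inE//.
    exact: (@measurable_digit_set n
      (fun t => (deint true n t < tr a)%N /\ (deint false n t < tr b)%N)).
  by move=> x /Sab[xa xb]; split; exact: sub.
apply: (le_trans (unif_box_le _ _ _)); rewrite lee_fin.
rewrite ler_pdivrMr ?exprn_gt0// (_ : 4 = 2 * 2 :> R); last by ring.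
rewrite exprMn [leRHS]mulrACA -[X in _ <= X]mulrACA.
rewrite [leRHS](_ : _ = (2 ^+ n * (a + (2 ^+ n)^-1)) *
  (2 ^+ n * (b + (2 ^+ n)^-1))); last by ring.
by apply: ler_pM => //; exact: le1.
Qed.

Let unif_event_lower n (a b : R) : 0 <= a <= 1 -> 0 <= b <= 1 ->
  ((a * b - 4 * (2 ^+ n)^-1)%:E <= U (event a b))%E.
Proof.
(* [half b x] may exceed its truncation by a full step [2^-n]; giving up one more cell keeps it
   strictly below [c]. Each side thus loses at most two steps, and the product at most four. *)
move=> /andP[a0 a1] /andP[b0 b1]; pose tr (c : R) := (Num.trunc (2 ^+ n * c)).-1.
have p0 : 0 < 2 ^+ n :> R by rewrite exprn_gt0.
have sub c b' x : 0 <= c -> (deint b' n (digits n x) < tr c)%N -> half b' x < c.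
  move=> c0 xc; apply: (le_lt_trans (half_le b' n x)).
  rewrite /half_ -[X in _ + X]mul1r -mulrDl ltr_pdivrMr// natr1.
  have /truncn_itv/andP[h _] : 0 <= 2 ^+ n * c by rewrite mulr_ge0// ltW.
  rewrite mulrC (lt_le_trans _ h)// ltr_nat; move: xc; rewrite /tr.
  by move: (Num.trunc _) => m; lia.
have tle c : 0 <= c <= 1 -> (tr c <= 2 ^ n)%N.
  move=> /andP[c0 c1]; apply: (@leq_trans (Num.trunc (2 ^+ n * c))).
    exact: leq_pred.
  rewrite truncn_le_nat (@le_lt_trans _ _ (2 ^+ n))//.
    by rewrite ler_piMr// ltW.
  by rewrite -natrX ltr_nat.
have trge c : 0 <= c -> c - 2 * (2 ^+ n)^-1 <= (tr c)%:R / 2 ^+ n.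
  move=> c0; rewrite ler_pdivlMr// mulrBl -mulrA mulVf ?gt_eqF// mulr1 mulrC.
  rewrite lerBlDr /tr.
  have := truncnS_gt (2 ^+ n * c); move: (Num.trunc _) => m /ltW/le_trans; apply.
  rewrite -natrD ler_nat; lia.
have tr1 c : 0 <= c <= 1 -> (tr c)%:R / 2 ^+ n <= 1 :> R.
  by move=> c01; rewrite ler_pdivrMr// mul1r -natrX ler_nat tle.
have tr0 c : 0 <= (tr c)%:R / 2 ^+ n :> R by rewrite divr_ge0// ltW.
apply: (@le_trans _ _ (U (box n (tr a) (tr b)))); last first.
  apply: le_measure; rewrite ?inE.
  - exact: (@measurable_digit_set n
      (fun t => (deint true n t < tr a)%N /\ (deint false n t < tr b)%N)).
  - exact: measurable_event.
  by rewrite /event => x [/= xa xb]; split => /=; rewrite in_itv/=; exact: sub.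
rewrite unif_box ?tle ?a0 ?b0// lee_fin (_ : 4 ^+ n = 2 ^+ n * 2 ^+ n :> R); last first.
  by rewrite -exprMn; congr (_ ^+ _); ring.
rewrite invfM mulrACA.
have := trge _ a0; have := trge _ b0; have := tr1 a; have := tr1 b.
have := tr0 a; have := tr0 b; rewrite a0 a1 b0 b1.
have : 0 < (2 ^+ n)^-1 :> R by rewrite invr_gt0.
move: ((2 ^+ n)^-1) ((tr a)%:R / _) ((tr b)%:R / _) => e A B.
by move=> e0 B0 A0 /(_ isT) B1 /(_ isT) A1 hB hA; nra.
Qed.

Let le_pow2 (c x : R) : 0 <= c -> (forall n, x <= c * (2 ^+ n)^-1) -> x <= 0.
Proof.
move=> c0 h; apply/ler_addgt0Pr => e e0; rewrite add0r.
apply: le_trans (h (Num.trunc (c / e)).+1) _.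
rewrite ler_pdivrMr ?exprn_gt0// -ler_pdivrMl// mulrC.
apply: le_trans (ltW (truncnS_gt _)) _.
by rewrite -natrX ler_nat ltnW// ltn_expl.
Qed.

Let unif_event_ge0 (a b : R) : 0 <= a -> 0 <= b ->
  U (event a b) = (Num.min a 1 * Num.min b 1)%:E.
Proof.
move=> a0 b0; have fin : U (event a b) \is a fin_num.
  by apply: fin_num_measure; exact: measurable_event.
have a'01 : 0 <= Num.min a 1 <= 1 by rewrite le_min a0 ler01 ge_min lexx orbT.
have b'01 : 0 <= Num.min b 1 <= 1 by rewrite le_min b0 ler01 ge_min lexx orbT.
have /andP[a'0 _] := a'01; have /andP[b'0 _] := b'01.
have up n : (U (event a b) <=
    ((Num.min a 1 + (2 ^+ n)^-1) * (Num.min b 1 + (2 ^+ n)^-1))%:E)%E.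
  apply: unif_event_upper => //; first exact: measurable_event.
  rewrite /event => x [/=]; rewrite !in_itv/= => xa xb.
  by rewrite !le_min !half_le1 !ltW.
have lo n : ((Num.min a 1 * Num.min b 1 - 4 * (2 ^+ n)^-1)%:E <= U (event a b))%E.
  apply: le_trans (@unif_event_lower n _ _ a'01 b'01) _.
  apply: le_measure; rewrite ?inE; [exact: measurable_event..|].
  rewrite /event => x [/=]; rewrite !in_itv/= !lt_min.
  by move=> /andP[? _] /andP[? _].
move: up lo a'01 b'01; rewrite -(fineK fin); set r := fine _.
move: (Num.min a 1) (Num.min b 1) => {a'0 b'0 fin a0 b0} A B up lo A01 B01.
have e0 n : 0 < (2 ^+ n : R)^-1 <= 1.
  by rewrite invr_gt0 exprn_gt0//= invf_le1 ?exprn_gt0// exprn_ege1// ler1n.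
congr EFin; apply/eqP; rewrite eq_le; apply/andP; split.
  rewrite -subr_le0; apply: (@le_pow2 4) => // n.
  have := up n; have := e0 n; rewrite lee_fin; move: (_^-1) => e.
  by move: A01 B01 => /andP[? ?] /andP[? ?] /andP[? ?] ?; nra.
rewrite -subr_le0; apply: (@le_pow2 4) => // n.
by have := lo n; rewrite lee_fin; lra.
Qed.

Let unif_ltE (a : R) : 0 <= a -> U `]-oo, a[%classic = (Num.min a 1)%:E.
Proof.
move=> a0; have [a1|a1] := leP a 1; first by rewrite unif_lt ?a0.
by rewrite unif_lt1// ltW.
Qed.

Let unif_event (a b : R) :
  U (event a b) = (U `]-oo, a[%classic * U `]-oo, b[%classic)%E.
Proof.
have [a0|a0] := ltP a 0.
  rewrite (unif_lt0 (ltW a0)) mul0e (_ : event a b = set0) ?measure0//.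
  rewrite /event; apply/seteqP; split => x //= -[/=]; rewrite !in_itv/=.
  by have := half_ge0 true x; lra.
have [b0|b0] := ltP b 0.
  rewrite (unif_lt0 (ltW b0)) mule0 (_ : event a b = set0) ?measure0//.
  rewrite /event; apply/seteqP; split => x //= -[/=]; rewrite !in_itv/=.
  by have := half_ge0 false x; lra.
by rewrite unif_event_ge0// !unif_ltE.
Qed.

Let measure_lt_scale (m : {measure set (measurableTypeR R) -> \bar R}) (c : \bar R) :
  (0 <= c)%E -> c \is a fin_num -> (m setT < +oo)%E ->
  (forall a : R, m `]-oo, a[%classic = c * U `]-oo, a[%classic)%E ->
  forall A, measurable A -> m A = (c * U A)%E.
Proof.
move=> c0 cfin mfin mc A mA; have r0 := fine_ge0 c0.
have cE : c = (NngNum r0)%:num%:E by rewrite /= fineK.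
rewrite [in RHS]cE.
apply: (@measure_lt_unique R m (mscale (NngNum r0) U)) => // a.
by rewrite mc [in LHS]cE.
Qed.

(** The product formula on quadrants is extended one coordinate at a time. With the second event
    fixed to a half-line, the trace measure of the first half is a multiple of [U] on half-lines,
    hence everywhere; then the first event is fixed to [A] and the argument repeats for the second
    half. *)
Lemma unif_half (A B : set (measurableTypeR R)) : measurable A -> measurable B ->
  U (half true @^-1` A `&` half false @^-1` B) = (U A * U B)%E.
Proof.
move=> mA mB.
pose f : measurableTypeR R -> measurableTypeR R := half true.
pose g : measurableTypeR R -> measurableTypeR R := half false.
have mf : measurable_fun setT f := measurable_half true.
have mg : measurable_fun setT g := measurable_half false.
have mfA C : measurable C -> measurable (f @^-1` C).
  by move=> mC; rewrite -[X in measurable X]setTI; exact: mf.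
have mgA C : measurable C -> measurable (g @^-1` C).
  by move=> mC; rewrite -[X in measurable X]setTI; exact: mg.
have S1 b C : measurable C ->
    U (f @^-1` C `&` g @^-1` `]-oo, b[) = (U `]-oo, b[%classic * U C)%E.
  move=> mC; have mD := mgA `]-oo, b[%classic (measurable_itv _).
  apply: (@measure_lt_scale (pushforward (mrestr U mD) f)) => //.
  - by apply: fin_num_measure; exact: measurable_itv.
  - rewrite /pushforward /mrestr; apply: le_lt_trans (probability_le1 U _) _ => //.
      exact: measurableI (mfA _ measurableT) mD.
    exact: ltry.
  - by move=> a; rewrite /pushforward /mrestr muleC -unif_event.
rewrite setIC; have mD := mfA _ mA.
apply: (@measure_lt_scale (pushforward (mrestr U mD) g)) => //.
- by apply: fin_num_measure.
- rewrite /pushforward /mrestr; apply: le_lt_trans (probability_le1 U _) _ => //.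
    exact: measurableI (mgA _ measurableT) mD.
  exact: ltry.
- move=> b; rewrite -[LHS]/(U (g @^-1` `]-oo, b[ `&` f @^-1` A)).
  by rewrite setIC S1// muleC.
Qed.

End digits.

(** * Independent sequences and runs *)

(** One sample [w] of [P] yields two independent samples [hd w] and [tl w], each again of law [P].
    Iterating on the tail produces an independent sequence without an infinite product space. *)
Definition splitting (R : realType) d (O : measurableType d)
    (P : probability O R) (hd tl : O -> O) : Prop :=
  forall A B : set O, measurable A -> measurable B ->
    P (hd @^-1` A `&` tl @^-1` B) = (P A * P B)%E.

Section iid.
Context {R : realType} d (O : measurableType d) (P : probability O R).
Context (hd tl : O -> O).
Hypothesis mhd : measurable_fun setT hd.
Hypothesis mtl : measurable_fun setT tl.
Hypothesis split : splitting P hd tl.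

Lemma integral_split (F : O * O -> \bar R) :
  measurable_fun setT F -> (forall x, 0 <= F x)%E ->
  (\int[P]_w F (hd w, tl w) = \int[P]_x \int[P]_y F (x, y))%E.
Proof.
move=> mF F0.
pose h (w : O) : O * O := (hd w, tl w).
have mh : measurable_fun setT h.
  by apply/measurable_fun_pairP; split.
have := @fubini_tonelli1 _ _ _ _ _ P P F mF F0; rewrite /fubini_F => <-.
transitivity (\int[pushforward P h]_z F z)%E.
  by rewrite ge0_integral_pushforward.
apply: eq_measure_integral => A mA _; apply/esym.
apply: (@product_measure_unique _ _ _ _ _ P P (pushforward P h)) => //.
Qed.

Lemma integral_head (G : O -> \bar R) :
  measurable_fun setT G -> (forall x, 0 <= G x)%E ->
  (\int[P]_w G (hd w) = \int[P]_x G x)%E.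
Proof.
move=> mG G0; rewrite (@integral_split (G \o fst))//=; last first.
  exact: measurableT_comp.
apply: eq_integral => x _.
by rewrite integral_cst// -[X in (_ * X)%E]/(P setT) probability_setT mule1.
Qed.

Definition xi (t : nat) (w : O) : O := hd (iter t tl w).

Lemma measurable_iter t : measurable_fun setT (iter t tl).
Proof.
elim: t => [|t IH]; first exact: measurable_id.
exact: measurableT_comp IH.
Qed.

Lemma measurable_xi t : measurable_fun setT (xi t).
Proof. exact: measurableT_comp (measurable_iter t). Qed.

Lemma preimage_measurable d' (S : measurableType d') (f : O -> S) (A : set S) :
  measurable_fun setT f -> measurable A -> measurable (f @^-1` A).
Proof. by move=> mf mA; rewrite -[X in measurable X]setTI; exact: mf. Qed.

(** The tail event [B] is carried along for the induction: one more coordinate is obtained by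
    applying [split] inside the tail. *)
Lemma xi_iid n (A : nat -> set O) (B : set O) :
  (forall t, measurable (A t)) -> measurable B ->
  P [set w | (forall t, (t < n)%N -> A t (xi t w)) /\ B (iter n tl w)] =
  ((\big[*%E/1%E]_(t < n) P (A t)) * P B)%E.
Proof.
move=> mA; elim: n B => [|n IH] B mB.
  rewrite big_ord0 mul1e; congr (P _); apply/seteqP; split => x /=; first by case.
  by split.
rewrite big_ord_recr/= -muleA -split// -IH; last first.
  by apply: measurableI; exact: preimage_measurable.
congr (P _); apply/seteqP; split => x /= [xA xB].
  by split => [t tn|]; [exact/xA/ltnW|split => //; exact: xA].
split => [t|]; last by case: xB.
by rewrite ltnS leq_eqVlt => /orP[/eqP->|/xA//]; case: xB.
Qed.

Lemma probability_xi t (A : set O) : measurable A -> P (xi t @^-1` A) = P A.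
Proof.
move=> mA; have := @xi_iid t.+1 (fun s => if s == t then A else setT) setT.
rewrite big_ord_recr/= eqxx big1 ?mul1e; last first.
  by move=> i _; rewrite ltn_eqF// probability_setT.
rewrite probability_setT mule1 => <-//; last by move=> s; case: ifP.
congr (P _); apply/seteqP; split => x /=.
  by move=> xA; split => // s _; case: eqP => // ->.
by move=> [/(_ t (ltnSn t))]; rewrite eqxx.
Qed.

Lemma independent_seq_xi d' (S : measurableType d') (W : O -> S) :
  measurable_fun setT W -> independent_seq P (fun t w => W (xi t w)).
Proof.
move=> mW n A mA.
have mWA t : measurable (W @^-1` A t) by exact: preimage_measurable.
have := @xi_iid n (fun t => W @^-1` A t) setT mWA measurableT.
rewrite probability_setT mule1 => xiE.
transitivity (P [set w | (forall t, (t < n)%N -> (W @^-1` A t) (xi t w)) /\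
    [set: O] (iter n tl w)]).
  by congr (P _); apply/seteqP; split => x /=; [|case].
rewrite xiE; apply: eq_bigr => t _.
by rewrite -(probability_xi t).
Qed.

End iid.

Lemma measurable_finsel d1 d2 (T : measurableType d1) (S : measurableType d2)
    (I : finType) (p : T -> I) (F : I -> T -> S) :
  (forall i, measurable (p @^-1` [set i])) ->
  (forall i, measurable_fun setT (F i)) ->
  measurable_fun setT (fun x => F (p x) x).
Proof.
move=> mp mF _ A mA; rewrite setTI.
rewrite (_ : _ @^-1` _ = \bigcup_(i in setT) (p @^-1` [set i] `&` F i @^-1` A)).
  apply: fin_bigcup_measurable; first exact: finite_finset.
  by move=> i _; apply: measurableI => //; exact: preimage_measurable.
by apply/seteqP; split => [x /= xA|x [i _ [/= -> //]]]; exists (p x).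
Qed.

Definition mk_mfun d1 d2 (T1 : measurableType d1) (T2 : measurableType d2)
    (f : T1 -> T2) (mf : measurable_fun setT f) : {mfun T1 >-> T2} :=
  HB.pack_for {mfun T1 >-> T2} f (isMeasurableFun.Build _ _ _ _ f mf).

Section iid_instance.
Context {R : realType} d (O : measurableType d) (P : probability O R).
Context (hd tl : O -> O).
Hypothesis mhd : measurable_fun setT hd.
Hypothesis mtl : measurable_fun setT tl.
Context (k : nat) (yf zf : 'I_k -> O -> R) (df : 'I_k -> O -> bool).
Hypothesis myf : forall i, measurable_fun setT (yf i).
Hypothesis mzf : forall i, measurable_fun setT (zf i).
Hypothesis mdf : forall i, measurable_fun setT (df i).

Let mxi t := measurable_xi mhd mtl t.

Definition iid_instance : cbai_instance R k := @CBAIInstance R k d O P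
  (fun i => distribution P
    (mk_mfun (myf i : measurable_fun _ (_ : O -> measurableTypeR R))))
  (fun i t => mk_mfun (measurableT_comp (myf i) (mxi t)))
  (fun i t => mk_mfun (measurableT_comp (mdf i) (mxi t)))
  (fun i t => mk_mfun (measurableT_comp (mzf i) (mxi t))).

Definition obs_fun (i : 'I_k) (u : O) : R :=
  (1 - (df i u)%:R) * yf i u + (df i u)%:R * zf i u.

Lemma measurable_obs_fun i : measurable_fun setT (obs_fun i).
Proof.
have md : measurable_fun setT (fun u => (df i u)%:R : R).
  by apply: (@measurableT_comp _ _ _ _ _ _ (fun b : bool => b%:R : R)).
apply: measurable_funD; apply: measurable_funM => //.
exact: measurable_funB.
Qed.

End iid_instance.

Section run.
Context {R : realType} d (O : measurableType d) (P : probability O R).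
Context (hd tl : O -> O).
Hypothesis mhd : measurable_fun setT hd.
Hypothesis mtl : measurable_fun setT tl.
Hypothesis split : splitting P hd tl.
Context (k : nat) (alg : algorithm R k).
Context (xf : 'I_k -> O -> R).
Hypothesis mxf : forall i, measurable_fun setT (xf i).

(** A copy of [observed] that depends on the observation functions instead of the instance record,
    so that the runs of two instances become two functions on the same space. *)
Fixpoint obs (w : O) (s : seed alg) (n : nat) : n.-tuple R :=
  match n return n.-tuple R with
  | 0 => [tuple]
  | n'.+1 => [tuple of rcons (obs w s n') (xf (pull (s, obs w s n')) (xi hd tl n' w))]
  end.

Definition state n (z : O * seed alg) : seed alg * n.-tuple R := (z.2, obs z.1 z.2 n).

Definition upd n (p : seed alg * n.-tuple R) (x : R) : seed alg * n.+1.-tuple R :=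
  (p.1, [tuple of rcons p.2 x]).

Definition sel n (p : seed alg * n.-tuple R) (u : O) : R := xf (pull p) u.

Lemma measurable_sel d' (T : measurableType d') n
    (f : T -> seed alg * n.-tuple R) (g : T -> O) :
  measurable_fun setT f -> measurable_fun setT g ->
  measurable_fun setT (fun x => sel (f x) (g x)).
Proof.
move=> mf mg; rewrite /sel.
apply: (@measurable_finsel _ _ _ _ _ (fun x => pull (f x)) (fun i x => xf i (g x))).
  by move=> i; exact: (preimage_measurable mf (@pull_measurable _ _ alg n i)).
by move=> i; exact: measurableT_comp.
Qed.

Lemma measurable_upd d' (T : measurableType d') n
    (f : T -> seed alg * n.-tuple R) (g : T -> R) :
  measurable_fun setT f -> measurable_fun setT g ->
  measurable_fun setT (fun x => upd (f x) (g x)).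
Proof.
move=> /measurable_fun_pairP[mf1 mf2] mg; apply/measurable_fun_pairP; split => //.
apply/measurable_fun_tnthP => i; rewrite /comp/=.
have [ilt|ige] := ltnP i n.
  rewrite (_ : (fun _ => _) = (fun x => tnth (f x).2 (Ordinal ilt))).
    by move/measurable_fun_tnthP : mf2 => /(_ (Ordinal ilt)).
  apply/funext => x; rewrite !(tnth_nth 0)/= nth_rcons size_tuple.
  by rewrite ilt.
rewrite (_ : (fun _ => _) = g)//.
apply/funext => x; rewrite (tnth_nth 0)/= nth_rcons size_tuple ltnNge ige/=.
by have := ltn_ord i; rewrite ltnS => ile; rewrite (_ : (i == n :> nat))// eqn_leq ile.
Qed.

Lemma measurable_state n : measurable_fun setT (@state n).
Proof.
elim: n => [|n IH].
  apply/measurable_fun_pairP; split; first exact: measurable_snd.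
  by apply/measurable_fun_tnthP => -[].
apply: (@measurable_upd _ _ n (@state n)
  (fun z => sel (state n z) (xi hd tl n z.1))) => //.
apply: measurable_sel => //; apply: measurableT_comp (measurable_fst) => //.
exact: measurable_xi.
Qed.

Local Notation PQ := (P \x seed_prob alg)%E.

(* After [n] iterations the tail of the randomness is fresh: it may be resampled
   independently of the history. *)
Lemma integral_fresh n (F : (seed alg * n.-tuple R) * O -> \bar R) :
  measurable_fun setT F -> (forall x, 0 <= F x)%E ->
  (\int[PQ]_z F (state n z, iter n tl z.1) =
   \int[PQ]_z \int[P]_w F (state n z, w))%E.
Proof.
elim: n F => [|n IH] F mF F0.
  have m0 : measurable_fun setT
      (fun s : seed alg => (s, [tuple]) : seed alg * 0.-tuple R).
    by apply/measurable_fun_pairP; split; [exact: measurable_id|exact: measurable_cst].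
  have mf : measurable_fun setT (fun z : O * seed alg => F ((z.2, [tuple]), z.1)).
    apply: measurableT_comp => //; apply/measurable_fun_pairP; split.
      exact: (measurableT_comp m0).
    exact: measurable_fst.
  have mh : measurable_fun setT (fun s : seed alg => \int[P]_w F ((s, [tuple]), w))%E.
    exact: measurableT_comp (measurable_fun_fubini_tonelli_F (m2 := P) _ mF F0) m0.
  have h0 s : (0 <= \int[P]_w F ((s : seed alg, [tuple]), w))%E by exact: integral_ge0.
  transitivity (\int[PQ]_z F ((z.2, [tuple]), z.1))%E; first by [].
  transitivity (\int[PQ]_z \int[P]_w F ((z.2, [tuple]), w))%E; last by [].
  rewrite (fubini_tonelli1 _ mf)// /fubini_F (fubini_tonelli _ mf)//=.
  rewrite (fubini_tonelli1 (fun z : O * seed alg =>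
    \int[P]_w F ((z.2, [tuple]), w))%E)//=; last first.
    exact: (measurableT_comp mh measurable_snd).
  rewrite /fubini_F/= integral_cst// -[X in (_ * X)%E]/(P setT).
  by rewrite probability_setT mule1.
(* One iteration is absorbed into the integrand, on the left as [F1] and on the right as [G1]. The
   induction hypothesis is applied to both, after which only a single draw has to be split into head
   and tail. *)
pose F1 (q : (seed alg * n.-tuple R) * O) := F (upd q.1 (sel q.1 (hd q.2)), tl q.2).
have mF1 : measurable_fun setT F1.
  apply: measurableT_comp => //; apply/measurable_fun_pairP; split.
    apply: measurable_upd; first exact: measurable_fst.
    apply: measurable_sel; first exact: measurable_fst.
    exact: measurableT_comp.
  by apply: (measurableT_comp mtl); exact: measurable_snd.
transitivity (\int[PQ]_z F1 (state n z, iter n tl z.1))%E; first by [].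
rewrite (IH F1)//; last by move=> ?; exact: F0.
pose G (p : seed alg * n.+1.-tuple R) := (\int[P]_w F (p, w))%E.
have mG : measurable_fun setT G by exact: measurable_fun_fubini_tonelli_F.
have G0 p : (0 <= G p)%E by exact: integral_ge0.
pose G1 (q : (seed alg * n.-tuple R) * O) := G (upd q.1 (sel q.1 (hd q.2))).
have mG1 : measurable_fun setT G1.
  apply: measurableT_comp => //.
  apply: measurable_upd; first exact: measurable_fst.
  apply: measurable_sel; first exact: measurable_fst.
  exact: measurableT_comp.
transitivity (\int[PQ]_z G1 (state n z, iter n tl z.1))%E; last by [].
rewrite (IH G1)//; last by move=> ?; exact: G0.
apply: eq_integral => z _.
transitivity (\int[P]_u \int[P]_w F (upd (state n z) (sel (state n z) u), w))%E.
  rewrite -(@integral_split _ _ _ _ _ _ mhd mtl split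
    (fun x => F (upd (state n z) (sel (state n z) x.1), x.2)))//.
  apply: measurableT_comp => //; apply/measurable_fun_pairP; split.
    apply: measurable_upd; first exact: measurable_cst.
    by apply: measurable_sel; [exact: measurable_cst|exact: measurable_fst].
  exact: measurable_snd.
apply/esym/(@integral_head _ _ _ _ _ _ mhd mtl split
  (fun u => G (upd (state n z) (sel (state n z) u)))) => //.
apply: measurableT_comp => //; apply: measurable_upd; first exact: measurable_cst.
by apply: measurable_sel; [exact: measurable_cst|exact: measurable_id].
Qed.

(** This plays the part of conditioning on the history: the next observation may be averaged out
    with the past frozen. *)
Lemma integral_step n (F : (seed alg * n.-tuple R) * R -> \bar R) :
  measurable_fun setT F -> (forall x, 0 <= F x)%E ->
  (\int[PQ]_z F (state n z, sel (state n z) (xi hd tl n z.1)) =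
   \int[PQ]_z \int[P]_u F (state n z, sel (state n z) u))%E.
Proof.
move=> mF F0.
have mF1 : measurable_fun setT
    (fun q : (seed alg * n.-tuple R) * O => F (q.1, sel q.1 (hd q.2))).
  apply: measurableT_comp => //; apply/measurable_fun_pairP; split => //.
    exact: measurable_fst.
  apply: measurable_sel; first exact: measurable_fst.
  exact: measurableT_comp.
rewrite (@integral_fresh n (fun q => F (q.1, sel q.1 (hd q.2))))//.
apply: eq_integral => z _ /=.
apply: (@integral_head _ _ _ _ _ _ mhd mtl split
  (fun u => F (state n z, sel (state n z) u))) => //.
apply: measurableT_comp => //; apply/measurable_fun_pairP; split.
  exact: measurable_cst.
by apply: measurable_sel; [exact: measurable_cst|exact: measurable_id].
Qed.

End run.

(** * The likelihood ratio of a run *)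

Section prefix.
Context {R : realType} d (S : measurableType d).

(** Truncation of a history to its first [t] observations, meaningful for [t <= n]; beyond that the
    tuple is padded with the default 0. *)
Definition pre t n (p : S * n.-tuple R) : S * t.-tuple R :=
  (p.1, [tuple nth 0 p.2 i | i < t]).

Lemma pre_id n (p : S * n.-tuple R) : pre n p = p.
Proof.
case: p => s h; congr (_, _); apply: eq_from_tnth => i.
by rewrite tnth_mktuple (tnth_nth 0).
Qed.

Lemma measurable_nth n t : measurable_fun setT (fun h : n.-tuple R => nth 0 h t).
Proof.
have [tn|nt] := ltnP t n.
  rewrite (_ : (fun _ => _) = (fun h : n.-tuple R => tnth h (Ordinal tn))).
    exact: measurable_tnth.
  by apply/funext => h; rewrite (tnth_nth 0).
rewrite (_ : (fun _ => _) = cst 0); first exact: measurable_cst.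
by apply/funext => h; rewrite nth_default// size_tuple.
Qed.

Lemma measurable_pre t n : measurable_fun setT (@pre t n).
Proof.
apply/measurable_fun_pairP; split; first exact: measurable_fst.
apply/measurable_fun_tnthP => i.
rewrite (_ : _ \o _ = (fun p : S * n.-tuple R => nth 0 p.2 i)).
  exact: (measurableT_comp (@measurable_nth n i) measurable_snd).
by apply/funext => p; rewrite /= tnth_mktuple.
Qed.

(** A predictable weight times a function of the next observation, summed as in a martingale
    transform. It covers the log-likelihood ratio of the full history ([pulled]), that of the
    stopped run ([active]), and the number of pulls ([active] with the constant 1). *)
Definition wsum (a : forall t, S * t.-tuple R -> R) (g : R -> R) n
    (p : S * n.-tuple R) : R :=
  \sum_(t < n) a t (pre t p) * g (nth 0 p.2 t).

Lemma measurable_wsum a g n : (forall t, measurable_fun setT (@a t)) ->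
  measurable_fun setT g -> measurable_fun setT (@wsum a g n).
Proof.
move=> ma mg; apply: measurable_sum => t; apply: measurable_funM.
  exact: (measurableT_comp (ma t) (@measurable_pre t n)).
apply: (measurableT_comp mg).
exact: (measurableT_comp (@measurable_nth n t) measurable_snd).
Qed.

End prefix.

Section likelihood.
Context {R : realType} d (O : measurableType d) (P : probability O R).
Context (hd tl : O -> O).
Hypothesis mhd : measurable_fun setT hd.
Hypothesis mtl : measurable_fun setT tl.
Hypothesis split : splitting P hd tl.
Context (k : nat) (alg : algorithm R k) (j : 'I_k).

Local Notation S := (seed alg).
Local Notation PQ := (P \x seed_prob alg)%E.

Lemma pre_upd t n (p : S * n.-tuple R) x : (t <= n)%N ->
  pre t (upd p x) = pre t p.
Proof.
move=> tn; congr (_, _); apply: eq_from_tnth => i; rewrite !tnth_mktuple/=.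
by rewrite nth_rcons size_tuple (leq_trans (ltn_ord i) tn).
Qed.

Lemma wsum_upd a g n (p : S * n.-tuple R) x :
  wsum a g (upd p x) = wsum a g p + a n p * g x.
Proof.
have E : \sum_(t < n) a t (pre t (upd p x)) * g (nth 0 (upd p x).2 t) =
    \sum_(t < n) a t (pre t p) * g (nth 0 p.2 t).
  apply: eq_bigr => t _.
  rewrite (pre_upd p x (ltnW (ltn_ord t))).
  rewrite [nth 0 (upd p x).2 t]nth_rcons size_tuple ltn_ord.
  by [].
rewrite /wsum big_ord_recr E.
rewrite (pre_upd p x (leqnn n)) pre_id.
by rewrite [nth 0 (upd p x).2 _]nth_rcons size_tuple ltnn eqxx.
Qed.

(** The product includes [s = t]: the value is 1 exactly when iteration [t] is really performed,
    whereas in [stopped] the product ends before [t]. *)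
Definition running t (p : S * t.-tuple R) : R :=
  \prod_(s < t.+1) (~~ halt (pre s p))%:R.

Definition stopped t (p : S * t.-tuple R) : R :=
  (halt p)%:R * \prod_(s < t) (~~ halt (pre s p))%:R.

Definition pulled t (p : S * t.-tuple R) : R := (pull p == j)%:R.

Definition active t (p : S * t.-tuple R) : R := running p * pulled p.

Definition errs t (p : S * t.-tuple R) : R := stopped p * (output p != j)%:R.

Lemma measurable_natb d' (T : measurableType d') (b : T -> bool) :
  measurable (b @^-1` [set true]) -> measurable_fun setT (fun x => (b x)%:R : R).
Proof.
move=> mb; apply: (@measurableT_comp _ _ _ _ _ _ (fun c : bool => c%:R : R)) => //.
by apply: (@measurable_fun_bool _ _ _ _ true); rewrite ?setTI.
Qed.

Lemma measurable_halt s t : measurable_fun setT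
  (fun p : S * t.-tuple R => (~~ halt (pre s p))%:R : R).
Proof.
have mh : measurable_fun setT (fun q : S * s.-tuple R => (~~ halt q)%:R : R).
  apply: measurable_natb.
  rewrite (_ : _ @^-1` _ = ~` (@halt _ _ alg s @^-1` [set true])).
    by apply: measurableC; exact: halt_measurable.
  by apply/seteqP; split => x /=; case: (halt x).
exact: (measurableT_comp mh (@measurable_pre _ _ _ s t)).
Qed.

Lemma measurable_pulled t : measurable_fun setT (@pulled t).
Proof.
apply: measurable_natb.
rewrite (_ : _ @^-1` _ = @pull _ _ alg t @^-1` [set j]).
  exact: pull_measurable.
by apply/seteqP; split => x /= /eqP.
Qed.

Lemma measurable_active t : measurable_fun setT (@active t).
Proof.
apply: measurable_funM; last exact: measurable_pulled.
by apply: measurable_prod => s _; exact: measurable_halt.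
Qed.

Lemma measurable_stopped t : measurable_fun setT (@stopped t).
Proof.
apply: measurable_funM.
  by apply: measurable_natb; exact: halt_measurable.
by apply: measurable_prod => s _; exact: measurable_halt.
Qed.

Lemma measurable_errs t : measurable_fun setT (@errs t).
Proof.
apply: measurable_funM; first exact: measurable_stopped.
apply: measurable_natb.
rewrite (_ : _ @^-1` _ = ~` (@output _ _ alg t @^-1` [set j])).
  by apply: measurableC; exact: output_measurable.
by apply/seteqP; split => x /= /eqP.
Qed.

Lemma pre_pre s t n (p : S * n.-tuple R) : (s <= t)%N -> pre s (pre t p) = pre s p.
Proof.
move=> st; congr (_, _); apply: eq_from_tnth => i; rewrite !tnth_mktuple.
have it : (i < t)%N by exact: leq_trans (ltn_ord i) st.
by rewrite -[LHS](tnth_nth 0 _ (Ordinal it)) tnth_mktuple.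
Qed.

Lemma natb_ge0 (b : bool) : 0 <= b%:R :> R. Proof. exact: ler0n. Qed.

Lemma natb_le1 (b : bool) : b%:R <= 1 :> R. Proof. by case: b. Qed.

Lemma running_ge0 t (p : S * t.-tuple R) : 0 <= running p.
Proof. by apply: prodr_ge0 => s _; exact: natb_ge0. Qed.

Lemma active_ge0 t (p : S * t.-tuple R) : 0 <= active p.
Proof. by rewrite mulr_ge0 ?running_ge0 ?natb_ge0. Qed.

Lemma stopped_ge0 t (p : S * t.-tuple R) : 0 <= stopped p.
Proof.
by rewrite mulr_ge0 ?natb_ge0//; apply: prodr_ge0 => s _; exact: natb_ge0.
Qed.

Lemma errs_ge0 t (p : S * t.-tuple R) : 0 <= errs p.
Proof. by rewrite mulr_ge0 ?stopped_ge0 ?natb_ge0. Qed.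

Lemma running01 t (p : S * t.-tuple R) : running p = 0 \/ running p = 1.
Proof.
rewrite /running; elim: t.+1 => [|m IH]; first by right; rewrite big_ord0.
rewrite big_ord_recr/=; case: IH => ->; first by left; rewrite mul0r.
by case: (halt _); rewrite mul1r; [left|right].
Qed.

Lemma running_le1 t (p : S * t.-tuple R) : running p <= 1.
Proof. by case: (running01 p) => ->. Qed.

(** Telescoping: being stopped at [t] is having run through all times before [t], minus having run
    through [t] as well. *)
Lemma sum_stopped n m (p : S * n.-tuple R) : (m <= n.+1)%N ->
  \sum_(t < m) stopped (pre t p) = 1 - \prod_(t < m) (~~ halt (pre t p))%:R.
Proof.
elim: m => [|m IH] mn; first by rewrite !big_ord0 subrr.
rewrite !big_ord_recr/= IH 1?ltnW// /stopped.
rewrite (_ : \prod_(s < m) (~~ halt (pre s (pre m p)))%:R =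
             \prod_(s < m) (~~ halt (pre s p))%:R); last first.
  by apply: eq_bigr => s _; rewrite pre_pre// ltnW.
by move: (\prod_(s < m) _) => Z; case: (halt _) => /=; ring.
Qed.

Lemma sum_errs_le1 n (p : S * n.-tuple R) :
  \sum_(t < n.+1) errs (pre t p) <= 1.
Proof.
apply: (@le_trans _ _ (\sum_(t < n.+1) stopped (pre t p))).
  by apply: ler_sum => t _; rewrite ler_piMr ?stopped_ge0// natb_le1.
rewrite sum_stopped// lerBlDr lerDl; apply: prodr_ge0 => s _.
exact: natb_ge0.
Qed.

(** Reconciles the two weights: the number of pulls is charged to [active], while the likelihood
    ratio at horizon [t] comes with [pulled]. When the run stops at [t], active terms vanish from
    [t] on and agree with pulled ones before. *)
Lemma wsum_stopped g t n (p : S * n.-tuple R) : (t <= n)%N ->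
  stopped (pre t p) != 0 ->
  wsum active g p = wsum pulled g (pre t p).
Proof.
move=> tn; rewrite mulf_eq0 negb_or => /andP[ht].
rewrite prodf_seq_neq0 => /allP/= hs; rewrite /wsum.
have nh s : (s < t)%N -> halt (pre s p) = false.
  move=> st; have := hs (Ordinal st); rewrite mem_index_enum => /(_ isT).
  rewrite pre_pre 1?ltnW//= pnatr_eq0 eqb0 negbK.
  by case: (halt _).
have hht : halt (pre t p) = true by move: ht; rewrite pnatr_eq0 eqb0 negbK.
rewrite -(big_mkord xpredT (fun s => active (pre s p) * g (nth 0 p.2 s))).
rewrite (big_cat_nat _ tn)//= addrC big_nat_cond big1 ?add0r; last first.
  move=> s /andP[/andP[ts _] _]; rewrite /active /running.
  have ts' : (t < s.+1)%N by [].
  by rewrite (bigD1 (Ordinal ts'))//= pre_pre// hht !mul0r.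
rewrite big_mkord; apply: eq_bigr => s _; rewrite pre_pre 1?ltnW//.
congr (_ * _).
  rewrite /active /running big1 ?mul1r// => r _.
  have rs : (r <= s)%N by rewrite -ltnS.
  by rewrite (pre_pre p rs) nh//; exact: leq_ltn_trans rs (ltn_ord s).
by congr g; rewrite -[RHS](tnth_nth 0 (pre t p).2 s) tnth_mktuple.
Qed.

Definition Phi (x : R) : R := expR x - 1 - x.

Lemma Phi_ge0 x : 0 <= Phi x.
Proof. by rewrite /Phi subr_ge0 lerBrDl; exact: expR_ge1Dx. Qed.

Lemma measurable_Phi : measurable_fun setT Phi.
Proof.
by apply: measurable_funB => //; apply: measurable_funB => //; exact: measurable_expR.
Qed.

(** For [e = 1] this is the tangent inequality [1 + y <= expR y] at [y = x + ln a^-1]; for [e = 0]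
    it is [0 <= Phi x]. Both sides are affine in [e]. *)
Lemma Phi_errs a x e : 0 < a <= 1 -> 0 <= e <= 1 ->
  e * ln a^-1 <= Phi x + (a^-1 - 1) * (e * expR x).
Proof.
move=> /andP[a0 a1] /andP[e0 e1].
have h0 := Phi_ge0 x.
have h1 : ln a^-1 <= Phi x + (a^-1 - 1) * expR x.
  have := expR_ge1Dx (x + ln a^-1); rewrite expRD lnK ?posrE ?invr_gt0//.
  by rewrite /Phi; move: (a^-1) (expR x) (ln _) => A E l; nra.
move: h0 h1; move: (Phi x) (ln _) ((a^-1 - 1)) (expR x) => F l A E h0 h1.
by nra.
Qed.

Section change_of_measure.
Variables (xf xf' : 'I_k -> O -> R) (g : R -> R) (K : R).
Hypothesis mxf : forall i, measurable_fun setT (xf i).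
Hypothesis mxf' : forall i, measurable_fun setT (xf' i).
Hypothesis mg : measurable_fun setT g.
Hypothesis K0 : 0 <= K.
Hypothesis PhiK : forall L : R,
  (\int[P]_u (Phi (L + g (xf j u)))%:E <= (Phi L + K)%:E)%E.
Hypothesis xf'E : forall i (h : R -> \bar R), i != j ->
  measurable_fun setT h -> (forall x, 0 <= h x)%E ->
  (\int[P]_u h (xf' i u) = \int[P]_u h (xf i u))%E.
Hypothesis xf'jE : forall (h : R -> \bar R),
  measurable_fun setT h -> (forall x, 0 <= h x)%E ->
  (\int[P]_u h (xf' j u) = \int[P]_u (h (xf j u) * (expR (g (xf j u)))%:E))%E.

Local Notation st x n z := (@state R d O hd tl k alg x n z).

Let stateS x n z :
  st x n.+1 z = upd (st x n z) (sel x (st x n z) (xi hd tl n z.1)).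
Proof. by []. Qed.

Let mst n : measurable_fun setT (fun z => st xf n z).
Proof. exact: measurable_state. Qed.
Let madd n : measurable_fun setT (@wsum _ _ S active g n).
Proof. by apply: measurable_wsum => // t; exact: measurable_active. Qed.

Let mcount n : measurable_fun setT (@wsum _ _ S active (cst 1) n).
Proof. by apply: measurable_wsum => // t; exact: measurable_active. Qed.

Let mint n (F : (S * n.-tuple R) * R -> \bar R) :
  measurable_fun setT F -> (forall q, 0 <= F q)%E ->
  measurable_fun setT (fun z => \int[P]_u F (st xf n z, sel xf (st xf n z) u))%E.
Proof.
move=> mF F0.
apply: (measurable_fun_fubini_tonelli_F (m2 := P)
  (fun q : (O * S) * O => F (st xf n q.1, sel xf (st xf n q.1) q.2))) => //.
have ms : measurable_fun setT (fun q : (O * S) * O => st xf n q.1).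
  exact: (measurableT_comp (@mst n) measurable_fst).
apply: (measurableT_comp mF); apply/measurable_fun_pairP; split => //.
apply: measurable_sel => //; exact: measurable_snd.
Qed.

(** Averaging out the last observation, an iteration that does not pull [j] or comes after stopping
    leaves the sum unchanged; any other adds at most [K] by [PhiK] and one to the count. *)
Lemma Phi_count n :
  (\int[PQ]_z (Phi (wsum active g (st xf n z)))%:E <=
   K%:E * \int[PQ]_z (wsum active (cst 1) (st xf n z))%:E)%E.
Proof.
elim: n => [|n IH].
  rewrite (eq_integral (cst 0%E)); last first.
    by move=> z _; rewrite /wsum big_ord0 /Phi expR0 subrr subr0.
  rewrite integral0 mule_ge0// integral_ge0// => z _.
  by rewrite /wsum big_ord0.
have mPadd : measurable_fun setT (fun q : (S * n.-tuple R) * R =>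
    (Phi (wsum active g q.1 + active q.1 * g q.2))%:E).
  apply/measurable_EFinP; apply: (measurableT_comp measurable_Phi).
  apply: measurable_funD; first exact: (measurableT_comp (@madd n) measurable_fst).
  apply: measurable_funM.
    exact: (measurableT_comp (@measurable_active n) measurable_fst).
  exact: (measurableT_comp mg measurable_snd).
under eq_integral do rewrite stateS wsum_upd.
rewrite (@integral_step _ _ _ _ _ _ mhd mtl split _ _ _ mxf n
  (fun q => (Phi (wsum active g q.1 + active q.1 * g q.2))%:E))//; last first.
  by move=> q; rewrite lee_fin Phi_ge0.
under [X in (_ <= _ * X)%E]eq_integral do rewrite stateS wsum_upd /= mulr1 EFinD.
have mc : measurable_fun setT (fun z => (wsum active (cst 1) (st xf n z))%:E).
  by apply/measurable_EFinP; exact: (measurableT_comp (@mcount n) (@mst n)).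
have ma : measurable_fun setT (fun z => (active (st xf n z))%:E).
  by apply/measurable_EFinP; exact: (measurableT_comp (@measurable_active n) (@mst n)).
have mP : measurable_fun setT (fun z => (Phi (wsum active g (st xf n z)))%:E).
  apply/measurable_EFinP; apply: (measurableT_comp measurable_Phi).
  exact: (measurableT_comp (@madd n) (@mst n)).
have c0 z : (0 <= (wsum active (cst 1) (st xf n z))%:E)%E.
  by rewrite lee_fin sumr_ge0// => t _; rewrite mulr1 active_ge0.
have a0 z : (0 <= (active (st xf n z))%:E)%E by rewrite lee_fin active_ge0.
have P0 z : (0 <= (Phi (wsum active g (st xf n z)))%:E)%E.
  by rewrite lee_fin Phi_ge0.
rewrite (ge0_integralD _ _ _ mc _ ma)// ge0_muleDr ?integral_ge0//.
apply: (@le_trans _ _ (\int[PQ]_z ((Phi (wsum active g (st xf n z)))%:E +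
    K%:E * (active (st xf n z))%:E))%E); last first.
  rewrite ge0_integralD//; last 2 first.
  - by move=> z _; rewrite mule_ge0.
  - exact: measurable_funeM.
  by rewrite ge0_integralZl// leeD2r.
apply: ge0_le_integral => //.
- by move=> z _; apply: integral_ge0 => u _; rewrite lee_fin Phi_ge0.
- apply: (mint mPadd) => q; by rewrite lee_fin Phi_ge0.
- by apply: emeasurable_funD => //; exact: measurable_funeM.
move=> z _ /=; set p := st xf n z.
have Z : active p = 0 -> (\int[P]_u (Phi (wsum active g p +
    active p * g (sel xf p u)))%:E <=
    (Phi (wsum active g p))%:E + K%:E * (active p)%:E)%E.
  move=> ->; rewrite mule0 adde0; under eq_integral do rewrite mul0r addr0.
  by rewrite integral_cst// -[X in (_ * X)%E]/(P setT) probability_setT mule1.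
have [pj|pj] := eqVneq (pull p) j; last first.
  by apply: Z; rewrite /active /pulled (negbTE pj) mulr0.
case: (running01 p) => rp; first by apply: Z; rewrite /active rp mul0r.
rewrite (_ : active p = 1); last by rewrite /active /pulled pj eqxx rp mulr1.
rewrite mule1 -EFinD; under eq_integral do rewrite mul1r /sel pj.
exact: PhiK.
Qed.

(** Induction with [f] general: the last observation is averaged out under [xf'], the induction
    hypothesis is applied to the resulting function of the shorter history, and the inner average is
    converted to [xf], at the cost of a factor [expR (g x)] when [j] is pulled. *)
Lemma change_of_measure n (f : S * n.-tuple R -> \bar R) :
  measurable_fun setT f -> (forall p, 0 <= f p)%E ->
  (\int[PQ]_z f (st xf' n z) =
   \int[PQ]_z (f (st xf n z) * (expR (wsum pulled g (st xf n z)))%:E))%E.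
Proof.
elim: n f => [|n IH] f mf f0.
  apply: eq_integral => z _; rewrite /wsum big_ord0 expR0 mule1.
  by congr f.
have mfu : measurable_fun setT (fun q : (S * n.-tuple R) * R => f (upd q.1 q.2)).
  apply: (measurableT_comp mf); apply: measurable_upd.
    exact: measurable_fst.
  exact: measurable_snd.
transitivity (\int[PQ]_z \int[P]_u f (upd (st xf' n z) (sel xf' (st xf' n z) u)))%E.
  exact: (@integral_step _ _ _ _ _ _ mhd mtl split _ _ _ mxf' n
    (fun q => f (upd q.1 q.2))).
pose G (p : S * n.-tuple R) := (\int[P]_u f (upd p (sel xf' p u)))%E.
have mG : measurable_fun setT G.
  apply: (measurable_fun_fubini_tonelli_F (m2 := P)
    (fun q : (S * n.-tuple R) * O => f (upd q.1 (sel xf' q.1 q.2)))) => //.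
  apply: (measurableT_comp mf); apply: measurable_upd; first exact: measurable_fst.
  by apply: (measurable_sel mxf'); [exact: measurable_fst|exact: measurable_snd].
have G0 p : (0 <= G p)%E by exact: integral_ge0.
rewrite -/(fun z => G (st xf' n z)) (IH G)//.
have mp : measurable_fun setT (@wsum _ _ S pulled g n).
  by apply: measurable_wsum => // t; exact: measurable_pulled.
transitivity (\int[PQ]_z \int[P]_u (f (upd (st xf n z) (sel xf (st xf n z) u)) *
    (expR (wsum pulled g (st xf n z) +
       pulled (st xf n z) * g (sel xf (st xf n z) u)))%:E))%E; last first.
  apply/esym; under eq_integral do rewrite stateS wsum_upd.
  apply: (@integral_step _ _ _ _ _ _ mhd mtl split _ _ _ mxf n (fun q =>
    f (upd q.1 q.2) * (expR (wsum pulled g q.1 + pulled q.1 * g q.2))%:E)%E).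
    apply: emeasurable_funM => //; apply/measurable_EFinP.
    apply: (measurableT_comp (@measurable_expR R)); apply: measurable_funD.
      exact: (measurableT_comp mp measurable_fst).
    apply: measurable_funM.
      exact: (measurableT_comp (@measurable_pulled n) measurable_fst).
    exact: (measurableT_comp mg measurable_snd).
  by move=> q; rewrite mule_ge0// lee_fin expR_ge0.
apply: eq_integral => z _; rewrite /G; set p := st xf n z.
have mfp : measurable_fun setT (fun x => f (upd p x)).
  by apply: (measurableT_comp mf); apply: measurable_upd.
under [RHS]eq_integral do rewrite expRD EFinM muleA muleAC.
have E0 : (0 <= (expR (wsum pulled g p))%:E)%E by rewrite lee_fin expR_ge0.
have mfx i : measurable_fun setT (fun u => f (upd p (xf i u))).
  exact: (measurableT_comp mfp (mxf i)).
have mfe i : measurable_fun setT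
    (fun u => f (upd p (xf i u)) * (expR (pulled p * g (xf i u)))%:E)%E.
  apply: emeasurable_funM => //; apply/measurable_EFinP.
  apply: (measurableT_comp (@measurable_expR R)); apply: measurable_funM => //.
  exact: (measurableT_comp mg (mxf i)).
rewrite /sel; have [pj|pj] := eqVneq (pull p) j; last first.
  rewrite (xf'E pj mfp)// ge0_integralZr//; last first.
    by move=> u _; rewrite mule_ge0// lee_fin expR_ge0.
  congr (_ * _)%E; apply: eq_integral => u _.
  by rewrite /pulled (negbTE pj) mul0r expR0 mule1.
have pE : pulled p = 1 by rewrite /pulled pj eqxx.
rewrite pj (xf'jE mfp (fun x => f0 _)); move: (mfe j); rewrite pE => mfej.
rewrite (ge0_integralZr _ measurableT mfej _ E0); last first.
  by move=> u _; rewrite mule_ge0// lee_fin expR_ge0.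
by congr (_ * _)%E; under [RHS]eq_integral do rewrite mul1r.
Qed.

Lemma pre_state x t n z : (t <= n)%N -> pre t (st x n z) = st x t z.
Proof.
elim: n => [|n IH]; first by rewrite leqn0 => /eqP ->; rewrite pre_id.
rewrite leq_eqVlt => /orP[/eqP ->|]; first by rewrite pre_id.
by rewrite ltnS => tn; rewrite stateS pre_upd// IH.
Qed.

Lemma likelihood_bound n a : 0 < a <= 1 ->
  ((ln a^-1)%:E * \sum_(t < n.+1) \int[PQ]_z (errs (st xf t z))%:E <=
   K%:E * \int[PQ]_z (wsum active (cst 1) (st xf n z))%:E +
   (a^-1 - 1)%:E * \sum_(t < n.+1) \int[PQ]_z (errs (st xf' t z))%:E)%E.
Proof.
move=> a01; have /andP[a0 a1] := a01.
have ia : 0 <= a^-1 - 1 by rewrite subr_ge0 invf_ge1.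
have la : 0 <= ln a^-1 by rewrite ln_ge0// invf_ge1.
have mer t : measurable_fun setT (fun z => errs (st xf t z)).
  by apply: (measurableT_comp (@measurable_errs t)); exact: mst.
have me t : measurable_fun setT (fun z => (errs (st xf t z))%:E).
  exact/measurable_EFinP.
have mE : measurable_fun setT (fun z => expR (wsum active g (st xf n z))).
  apply: (measurableT_comp (@measurable_expR R)).
  exact: (measurableT_comp (@madd n) (@mst n)).
have mP : measurable_fun setT (fun z => (Phi (wsum active g (st xf n z)))%:E).
  apply/measurable_EFinP; apply: (measurableT_comp measurable_Phi).
  exact: (measurableT_comp (@madd n) (@mst n)).
have e0 x t z : (0 <= (errs (st x t z))%:E)%E by rewrite lee_fin errs_ge0.
have eE0 t z : (0 <= (errs (st xf t z) * expR (wsum active g (st xf n z)))%:E)%E.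
  by rewrite lee_fin mulr_ge0 ?errs_ge0 ?expR_ge0.
have meE t : measurable_fun setT
    (fun z => (errs (st xf t z) * expR (wsum active g (st xf n z)))%:E).
  by apply/measurable_EFinP; exact: measurable_funM.
have -> : (\sum_(t < n.+1) \int[PQ]_z (errs (st xf' t z))%:E =
    \int[PQ]_z \sum_(t < n.+1)
      (errs (st xf t z) * expR (wsum active g (st xf n z)))%:E)%E.
  rewrite ge0_integral_sum//; apply: eq_bigr => t _.
  (* The measure is changed at the horizon [t] of each term; [wsum_stopped] then brings every
     exponent to the common horizon [n], so that [Phi_errs] applies pointwise to the sum. *)
  rewrite (@change_of_measure t (fun p => (errs p)%:E)); last 2 first.
  - by apply/measurable_EFinP; exact: measurable_errs.
  - by move=> p; rewrite lee_fin errs_ge0.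
  apply: eq_integral => z _; rewrite -EFinM; congr EFin.
  have tn : (t <= n)%N by rewrite -ltnS.
  rewrite -(pre_state xf z tn).
  have [s0|s0] := eqVneq (stopped (pre t (st xf n z))) 0.
    by rewrite /errs s0 !mul0r.
  by rewrite -(wsum_stopped g tn s0).
have mS1 : measurable_fun setT (fun z => \sum_(t < n.+1) (errs (st xf t z))%:E)%E.
  by apply: emeasurable_sum.
have mS2 : measurable_fun setT (fun z => \sum_(t < n.+1)
    (errs (st xf t z) * expR (wsum active g (st xf n z)))%:E)%E.
  by apply: emeasurable_sum.
have S1 z : (0 <= \sum_(t < n.+1) (errs (st xf t z))%:E)%E by apply: sume_ge0.
have S2 z : (0 <= \sum_(t < n.+1)
    (errs (st xf t z) * expR (wsum active g (st xf n z)))%:E)%E.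
  by apply: sume_ge0.
rewrite -ge0_integral_sum// -(ge0_integralZl _ _ mS1)//.
rewrite -(ge0_integralZl _ _ mS2)//.
apply: le_trans (leeD2r _ (Phi_count n)).
have P0 z : (0 <= (Phi (wsum active g (st xf n z)))%:E)%E.
  by rewrite lee_fin Phi_ge0.
have R0 z : (0 <= (a^-1 - 1)%:E * \sum_(t < n.+1)
    (errs (st xf t z) * expR (wsum active g (st xf n z)))%:E)%E.
  by rewrite mule_ge0.
have mR : measurable_fun setT (fun z => (a^-1 - 1)%:E * \sum_(t < n.+1)
    (errs (st xf t z) * expR (wsum active g (st xf n z)))%:E)%E.
  exact: measurable_funeM.
rewrite -(ge0_integralD _ _ _ mP _ mR)//.
apply: ge0_le_integral => //.
- by move=> z _; rewrite mule_ge0.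
- exact: measurable_funeM.
- exact: emeasurable_funD.
move=> z _; rewrite !sumEFin -!EFinM -EFinD lee_fin.
have h := @Phi_errs a (wsum active g (st xf n z))
  (\sum_(t < n.+1) errs (st xf t z)) a01.
rewrite -mulr_suml mulrC; apply: h.
rewrite sumr_ge0//=; last by move=> *; exact: errs_ge0.
rewrite (eq_bigr (fun t : 'I_n.+1 => errs (pre t (st xf n z)))) ?sum_errs_le1// => t _.
by rewrite pre_state// -ltnS.
Qed.

End change_of_measure.

End likelihood.

(** The integral of a nonnegative function is a supremum over simple functions below it, so
    monotonicity holds without measurability. In particular it applies to [sample_complexity], whose
    measurability is not established. *)
Lemma ge0_le_integralT d (T : measurableType d) (R : realType)
    (mu : {measure set T -> \bar R}) (f1 f2 : T -> \bar R) :
  (forall x, 0 <= f1 x)%E -> (forall x, f1 x <= f2 x)%E ->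
  (\int[mu]_x f1 x <= \int[mu]_x f2 x)%E.
Proof.
move=> f10 f12; have f20 x : (0 <= f2 x)%E by exact: le_trans (f10 x) (f12 x).
rewrite !ge0_integralTE//; apply: ge_ereal_sup => _ [h hf <-].
by apply: ereal_sup_ubound; exists h => // x; exact: le_trans (hf x) (f12 x).
Qed.

(** * From runs of an instance to indicators of stopping, error and pulls *)

Section sampling.
Context {R : realType} d (O : measurableType d) (P : probability O R).
Context (hd tl : O -> O).
Hypothesis mhd : measurable_fun setT hd.
Hypothesis mtl : measurable_fun setT tl.
Hypothesis split : splitting P hd tl.
Context (k : nat) (yf zf : 'I_k -> O -> R) (df : 'I_k -> O -> bool).
Hypothesis myf : forall i, measurable_fun setT (yf i).
Hypothesis mzf : forall i, measurable_fun setT (zf i).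
Hypothesis mdf : forall i, measurable_fun setT (df i).
Context (alg : algorithm R k).

Local Notation I := (iid_instance P mhd mtl myf mzf mdf).
Local Notation S := (seed alg).
Local Notation PQ := (P \x seed_prob alg)%E.
Local Notation xf := (obs_fun yf zf df).
Local Notation st n z := (@state R d O hd tl k alg xf n z).

Let mxf i : measurable_fun setT (xf i).
Proof. exact: measurable_obs_fun. Qed.

Let mst n : measurable_fun setT (fun z => st n z).
Proof. exact: measurable_state. Qed.

Lemma observedE n (z : run_space alg I) :
  (z.2, observed z n) = st n z.
Proof. by elim: n => [//|n] [] /= ->. Qed.

Lemma stops_atE t (z : run_space alg I) :
  stops_at t z <-> halt (st t z) /\ forall s, (s < t)%N -> ~~ halt (st s z).
Proof.
rewrite /stops_at observedE; split => -[h hs]; split => // s st';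
  by move: (hs s st'); rewrite observedE.
Qed.

Lemma stopped_stops t (z : run_space alg I) : stops_at t z -> stopped (st t z) = 1.
Proof.
move=> /stops_atE[h hs]; rewrite /stopped h mul1r big1// => s _.
by rewrite pre_state 1?ltnW// (hs s).
Qed.

Lemma stopped_nstops t (z : run_space alg I) : ~ stops_at t z -> stopped (st t z) = 0.
Proof.
move=> ns; apply/eqP; apply: contrapT => /negP; rewrite /stopped mulf_eq0 negb_or.
rewrite prodf_seq_neq0 => /andP[h /allP/= hs]; apply: ns; apply/stops_atE; split.
  by move: h; rewrite pnatr_eq0 eqb0 negbK.
move=> s st'; have := hs (Ordinal st'); rewrite mem_index_enum => /(_ isT).
by rewrite pre_state 1?ltnW//= pnatr_eq0 eqb0 negbK.
Qed.

Lemma stops_at_inj s t (z : run_space alg I) : stops_at s z -> stops_at t z -> s = t.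
Proof.
move=> [hs ns] [ht nt]; apply/eqP; rewrite eqn_leq.
by apply/andP; split; rewrite leqNgt; apply/negP => /[dup];
  [move=> /ns; rewrite ht|move=> /nt; rewrite hs].
Qed.

Let mstopped t : measurable_fun setT (fun z => stopped (st t z)).
Proof.
exact: (measurableT_comp (@measurable_stopped _ _ alg t) (@mst t)).
Qed.

Let stops_atEset t : [set z : run_space alg I | stops_at t z] =
  (fun z => stopped (st t z)) @^-1` [set 1].
Proof.
apply/seteqP; split => z /=; first exact: stopped_stops.
move=> z1; apply: contrapT => /stopped_nstops; rewrite z1 => /eqP.
by rewrite oner_eq0.
Qed.

Lemma measurable_stops_at t :
  measurable ([set z : run_space alg I | stops_at t z] : set (O * S)).
Proof. by rewrite stops_atEset -[X in measurable X]setTI; exact: mstopped. Qed.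

Lemma measurable_outputs i :
  measurable ([set z : run_space alg I | outputs i z] : set (O * S)).
Proof.
rewrite (_ : [set _ | _] = \bigcup_t ([set z : run_space alg I | stops_at t z] `&`
   (fun z => st t z) @^-1` (@output _ _ alg t @^-1` [set i]))).
  apply: bigcup_measurable => t _; apply: measurableI; first exact: measurable_stops_at.
  exact: (preimage_measurable (@mst t) (@output_measurable _ _ alg t i)).
apply/seteqP; split => z /=.
  by move=> [t zt ti]; exists t => //; split => //=; rewrite -observedE.
by move=> [t _ [zt ti]]; exists t => //; rewrite observedE.
Qed.

Lemma errs_stops j t (z : run_space alg I) : stops_at t z ->
  errs j (st t z) = (output (st t z) != j)%:R.
Proof. by move=> zt; rewrite /errs stopped_stops// mul1r. Qed.

Lemma errs_outputs j t (z : run_space alg I) : outputs j z -> errs j (st t z) = 0.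
Proof.
move=> [s zs]; rewrite observedE => sj.
have [zt|zt] := pselect (stops_at t z); last by rewrite /errs stopped_nstops// mul0r.
by rewrite errs_stops//; move: sj; rewrite (stops_at_inj zs zt) => ->; rewrite eqxx.
Qed.

Lemma errs_integral_le j n (delta : R) :
  ((1 - delta)%:E <= PQ [set z : run_space alg I | outputs j z])%E ->
  (\sum_(t < n.+1) \int[PQ]_z (errs j (st t z))%:E <= delta%:E)%E.
Proof.
move=> hP; have mo := measurable_outputs j.
have me t : measurable_fun setT (fun z => (errs j (st t z))%:E).
  apply/measurable_EFinP.
  exact: (measurableT_comp (@measurable_errs _ _ alg j t) (@mst t)).
rewrite -ge0_integral_sum//; last by move=> t z _; rewrite lee_fin errs_ge0.
apply: (@le_trans _ _ (PQ (~` [set z : run_space alg I | outputs j z]))); last first.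
  rewrite probability_setC// leeBlDr; last exact: fin_num_measure.
  by rewrite -leeBlDl// -EFinB.
rewrite -[X in PQ X]setIT -integral_indic//; last exact: measurableC.
apply: ge0_le_integralT => z.
  by apply: sume_ge0 => t _; rewrite lee_fin errs_ge0.
have [zo|zo] := pselect (@outputs R k alg I j z).
  by rewrite big1 ?lee_fin// => t _; rewrite errs_outputs.
rewrite sumEFin lee_fin indicE mem_set//=.
rewrite (eq_bigr (fun t : 'I_n.+1 => errs j (pre t (st n z)))) ?sum_errs_le1// => t _.
by rewrite pre_state// -ltnS.
Qed.

(** Continuity from below along the increasing events of having stopped by time [n], whose union has
    probability 1. *)
Lemma stopped_mass (eta : R) : as_finite alg I -> 0 < eta ->
  exists n : nat, ((1 - eta)%:E <= \sum_(t < n.+1) \int[PQ]_z (stopped (st t z))%:E)%E.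
Proof.
move=> fin eta0.
pose F n : set (O * S) :=
  [set z : run_space alg I | exists2 t, (t < n.+1)%N & stops_at t z].
have mF n : measurable (F n).
  rewrite (_ : F n = \bigcup_(t < n.+1) [set z : run_space alg I | stops_at t z]).
    by apply: bigcup_measurable => t _; exact: measurable_stops_at.
  by apply/seteqP; split => z [t tn zt]; exists t.
have FT : PQ (\bigcup_n F n) = 1%E.
  rewrite -fin; congr (_ _); apply/seteqP; split => z /=.
    by move=> [n _ [t _ zt]]; exists t.
  by move=> [t zt]; exists t => //; exists t.
have Fcvg : PQ (F n) @[n --> \oo] --> 1%E.
  rewrite -FT; apply: nondecreasing_cvg_mu => //; first exact: bigcup_measurable.
  move=> m n mn; apply/subsetPset => z [t tm zt]; exists t => //.
  exact: leq_trans tm _.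
have [n hn] : exists n, ((1 - eta)%:E <= PQ (F n))%E.
  have /fine_cvgP[_ /cvgrPdist_le/(_ _ eta0)[n _ /(_ n (leqnn n))/= hn]] := Fcvg.
  exists n; rewrite -(@fineK _ (PQ (F n))); last first.
    by rewrite ge0_fin_numE//; apply: le_lt_trans (probability_le1 _ (mF n)) (ltry _).
  by rewrite lee_fin; move: hn; rewrite ler_norml => /andP[_]; lra.
exists n; apply: (le_trans hn).
have ms t : measurable_fun setT (fun z => (stopped (st t z))%:E).
  exact/measurable_EFinP.
have s0 t z : (0 <= (stopped (st t z))%:E)%E by rewrite lee_fin stopped_ge0.
rewrite -ge0_integral_sum// -[X in PQ X]setIT -integral_indic//.
apply: ge0_le_integralT => z; first by rewrite lee_fin indicE.
rewrite indicE; have [/set_mem[t tn zt]|_] := boolP (z \in F n); last exact: sume_ge0.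
by rewrite (bigD1 (Ordinal tn))//= stopped_stops// leeDl// sume_ge0.
Qed.

(** A stopped run outputs one arm, so it misses at least one of two distinct arms. *)
Lemma errs_pair i j n : i != j ->
  (\sum_(t < n.+1) \int[PQ]_z (stopped (st t z))%:E <=
   \sum_(t < n.+1) \int[PQ]_z (errs i (st t z))%:E +
   \sum_(t < n.+1) \int[PQ]_z (errs j (st t z))%:E)%E.
Proof.
move=> ij; rewrite -big_split/=; apply: lee_sum => t _.
have me i' : measurable_fun setT (fun z => (errs i' (st t z))%:E).
  apply/measurable_EFinP.
  exact: (measurableT_comp (@measurable_errs _ _ alg i' t) (@mst t)).
have e0 i' z : (0 <= (errs i' (st t z))%:E)%E by rewrite lee_fin errs_ge0.
rewrite -ge0_integralD//; apply: ge0_le_integralT => z.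
  by rewrite lee_fin stopped_ge0.
rewrite -EFinD lee_fin /errs -mulrDr ler_peMr ?stopped_ge0//.
have [->|] := eqVneq (output (st t z)) i; first by rewrite ij add0r.
by rewrite lerDl natb_ge0.
Qed.

Lemma sum_pulled_le1 t (p : S * t.-tuple R) j0 :
  \sum_(j | j != j0) pulled j p <= 1 :> R.
Proof.
have <- : \sum_j pulled j p = 1 :> R.
  rewrite (bigD1 (pull p))//= big1 ?addr0 => [|i /negbTE ip].
    by rewrite /pulled eqxx.
  by rewrite /pulled eq_sym ip.
by rewrite [leRHS](bigD1 j0)//= lerDr natb_ge0.
Qed.

Lemma running_stops s t (z : run_space alg I) : stops_at t z -> (t <= s)%N ->
  running (st s z) = 0.
Proof.
move=> /stops_atE[h _] ts; rewrite /running.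
by rewrite (bigD1 (Ordinal (ts : (t < s.+1)%N)))//= pre_state// h mul0r.
Qed.

Local Notation count n j z := (wsum (@active R k alg j) (cst 1) (st n z)).

Lemma count_le n (z : run_space alg I) j0 :
  ((\sum_(j | j != j0) count n j z)%:E <= sample_complexity z)%E.
Proof.
apply: (@le_trans _ _ (\sum_(t < n) running (st t z))%:E).
  rewrite lee_fin exchange_big/=; apply: ler_sum => t _.
  under eq_bigr do rewrite mulr1 pre_state 1?ltnW//.
  by rewrite -mulr_sumr ler_piMr ?running_ge0// sum_pulled_le1.
(* A run that never stops has an empty set of stopping times and an infinite infimum; only an actual
   stopping time [T] has to be compared. *)
apply: le_ereal_inf_tmp => _ [T zT <-]; rewrite lee_fin.
apply: (@le_trans _ _ (\sum_(t < n) (t < T)%:R)).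
  apply: ler_sum => t _; have [tT|Tt] := ltnP t T; first exact: running_le1.
  by rewrite (running_stops zT).
rewrite -natr_sum ler_nat.
suff : (\sum_(t < n) (t < T) <= minn n T)%N by move/leq_trans; apply; exact: geq_minr.
elim: (n) => [|m IH]; first by rewrite big_ord0.
rewrite big_ord_recr/=; move: IH; move: (\sum_(_ < m) _)%N => q.
by rewrite !leq_min => /andP[q1 q2]; case: (ltnP m T) => h /=; apply/andP; split; lia.
Qed.

Lemma expected_count n j0 :
  (\sum_(j | j != j0) \int[PQ]_z (count n j z)%:E <=
   expected_sample_complexity alg I)%E.
Proof.
have mc j : measurable_fun setT (fun z => (count n j z)%:E).
  apply/measurable_EFinP; apply: (measurableT_comp _ (@mst n)).
  by apply: measurable_wsum => // t; exact: measurable_active.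
have c0 j z : 0 <= count n j z.
  by apply: sumr_ge0 => t _; rewrite mulr1 active_ge0.
rewrite -big_filter -ge0_integral_sum//; last by move=> j z _; rewrite lee_fin.
apply: ge0_le_integralT => z; rewrite big_filter.
  by apply: sume_ge0 => j _; rewrite lee_fin.
by rewrite sumEFin; exact: count_le.
Qed.

End sampling.

(** * Clean and observed laws *)

Section mixture.
Variable R : realType.
Local Notation U := (@unif R).
Local Notation O := (measurableTypeR R).
Local Notation hd := (half true : O -> O).
Local Notation tl := (half false : O -> O).

Let mhd : measurable_fun setT hd := @measurable_half R true.
Let mtl : measurable_fun setT tl := @measurable_half R false.

Lemma splitting_half : splitting U hd tl.
Proof. by move=> A B; exact: unif_half. Qed.

Definition pos (w : O) : R := 6 * hd w - 3.

Lemma measurable_pos : measurable_fun setT pos.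
Proof. by apply: measurable_funB => //; exact: measurable_funM. Qed.

Lemma pos_bounds w : -3 <= pos w <= 3.
Proof. by rewrite /pos; have := half_ge0 true w; have := half_le1 true w; lra. Qed.

(** [tl w] selects the component and [hd w] gives the position in the continuous part, so that the
    two are independent. *)
Definition mixt (bL bR : O -> bool) (w : O) : R :=
  if bL (tl w) then -4 else if bR (tl w) then 4 else pos w.

(** The mean of [h] under the law with masses [l] at -4 and [r] at 4 and the rest uniform on
    [[-3, 3]]. Laws are compared through this functional, which depends on the two masses only. *)
Definition mixtJ (l r : R) (h : R -> \bar R) : \bar R :=
  (l%:E * h (-4)%R + r%:E * h 4%R + (1 - l - r)%:E * \int[U]_w h (pos w))%E.

Lemma integral_mixt (bL bR : O -> bool) (l r : R) (h : R -> \bar R) :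
  measurable_fun setT bL -> measurable_fun setT bR ->
  (forall y, ~~ (bL y && bR y)) ->
  U [set y | bL y] = l%:E -> U [set y | bR y] = r%:E ->
  measurable_fun setT h -> (forall x, 0 <= h x)%E ->
  (\int[U]_w h (mixt bL bR w) = mixtJ l r h)%E.
Proof.
move=> mL mR dis Ul Ur mh h0.
have mLs : measurable [set y | bL y].
  by have := mL measurableT [set true]; rewrite setTI; exact.
have mRs : measurable [set y | bR y].
  by have := mR measurableT [set true]; rewrite setTI; exact.
set C := ~` ([set y | bL y] `|` [set y | bR y]).
have mC : measurable C by apply: measurableC; exact: measurableU.
have UC : U C = (1 - l - r)%:E.
  rewrite probability_setC; last exact: measurableU.
  rewrite (_ : U _ = (l + r)%:E) -?EFinB ?opprD ?addrA// EFinD -Ul -Ur.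
  apply: measureU => //; apply/seteqP; split => y //= -[yL yR].
  by have := dis y; rewrite yL yR.
pose F (q : O * O) :=
  (h (if bL q.2 then -4 else if bR q.2 then 4 else (6 * q.1 - 3))%R)%E.
have mF : measurable_fun setT F.
  apply: (measurableT_comp mh); apply: measurable_fun_ifT => //.
    exact: (measurableT_comp mL measurable_snd).
  apply: measurable_fun_ifT => //.
    exact: (measurableT_comp mR measurable_snd).
  by apply: measurable_funB => //; apply: measurable_funM => //; exact: measurable_fst.
transitivity (\int[U]_w F (hd w, tl w))%E; first by [].
rewrite (integral_split mhd mtl splitting_half mF); last by move=> q; exact: h0.
have inner x : (\int[U]_y F (x, y) =
    l%:E * h (-4)%R + r%:E * h 4%R + (1 - l - r)%:E * h (6 * x - 3)%R)%E.
  transitivity (\int[U]_y (h (-4)%R * (\1_[set y | bL y] y)%:E +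
      h 4%R * (\1_[set y | bR y] y)%:E + h (6 * x - 3)%R * (\1_C y)%:E))%E.
    apply: eq_integral => y _; rewrite /F/= !indicE.
    have -> : (y \in C) = ~~ (bL y || bR y).
      apply/idP/idP; rewrite inE /C/=.
        by move=> yC; apply/negP => /orP yLR; apply: yC.
      by move=> /negP yC /orP.
    have mb (b : O -> bool) : (y \in [set y | b y]) = b y.
      by apply/idP/idP; rewrite inE.
    rewrite !mb; have := dis y.
    case: (bL y) => /=; case: (bR y) => //= _;
      by rewrite ?(mule1, mule0, adde0, add0e).
  have mi A c : measurable A -> measurable_fun setT (fun y : O => c * (\1_A y)%:E)%E.
    by move=> mA; apply: measurable_funeM; exact/measurable_EFinP.
  have i0 A c : (0 <= c)%E -> forall y : O, (0 <= c * (\1_A y)%:E)%E.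
    by move=> c0 y; rewrite mule_ge0// lee_fin.
  have ie A c : measurable A -> (0 <= c)%E ->
      (\int[U]_y (c * (\1_A y)%:E) = c * U A)%E.
    move=> mA c0; rewrite ge0_integralZl//; last exact/measurable_EFinP.
    by rewrite integral_indic// setIT.
  rewrite ge0_integralD//; last 4 first.
  - by move=> y _; rewrite adde_ge0// i0.
  - by apply: emeasurable_funD; exact: mi.
  - by move=> y _; exact: i0.
  - exact: mi.
  rewrite ge0_integralD//; last 4 first.
  - by move=> y _; exact: i0.
  - exact: mi.
  - by move=> y _; exact: i0.
  - exact: mi.
  by rewrite !ie// UC; congr (_ + _ + _)%E; rewrite muleC ?Ul ?Ur.
under eq_integral do rewrite inner.
have l0 : (0 <= l%:E)%E by rewrite -Ul.
have r0 : (0 <= r%:E)%E by rewrite -Ur.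
have c0 : (0 <= (1 - l - r)%:E)%E by rewrite -UC.
have mx : measurable_fun setT (fun x : O => h (6 * x - 3)%R).
  by apply: (measurableT_comp mh); apply: measurable_funB => //; exact: measurable_funM.
rewrite ge0_integralD//; last 3 first.
- by move=> x _; rewrite adde_ge0// mule_ge0.
- by move=> x _; rewrite mule_ge0.
- exact: measurable_funeM.
rewrite integral_cst// -[X in (_ * X)%E]/(U setT) probability_setT mule1.
rewrite ge0_integralZl//; congr (_ + _ * _)%E.
by rewrite -(integral_head mhd mtl splitting_half mx).
Qed.

Lemma unif_ltb (a : R) : 0 <= a <= 1 -> U [set y : O | y < a] = a%:E.
Proof. by move=> a01; rewrite -(unif_lt a01); congr (U _). Qed.

Lemma unif_geb (a : R) : 0 <= a <= 1 -> U [set y : O | a <= y] = (1 - a)%:E.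
Proof.
move=> a01.
have m : measurable ([set y | y < a] : set O).
  have -> : [set y : O | y < a] = `]-oo, a[%classic.
    by apply/seteqP; split => y /=; rewrite in_itv.
  exact: measurable_itv.
rewrite EFinB -(unif_ltb a01) -(probability_setC U m); congr (U _).
by apply/seteqP; split => y /=; rewrite leNgt => /negP.
Qed.

Section clipped_law.
Variables (bL bR : O -> bool) (m : R).
Hypothesis mL : measurable_fun setT bL.
Hypothesis mR : measurable_fun setT bR.
Hypothesis dis : forall y, ~~ (bL y && bR y).
Hypothesis UL : U [set y | bL y] = ((1 - m) / 8)%:E.
Hypothesis UR : U [set y | bR y] = ((1 + m) / 8)%:E.
Hypothesis m1b : `|m| <= 9 / 10.

Lemma measurable_mixt : measurable_fun setT (mixt bL bR).
Proof.
apply: measurable_fun_ifT => //; first exact: (measurableT_comp mL mtl).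
apply: measurable_fun_ifT => //; first exact: (measurableT_comp mR mtl).
exact: measurable_pos.
Qed.

Let F : law R := distribution U
  (mk_mfun (measurable_mixt : measurable_fun _ (_ : O -> O))).

Let FE (A : set O) : measurable A ->
  F A = (((1 - m) / 8)%:E * (\1_A (-4))%:E + ((1 + m) / 8)%:E * (\1_A 4)%:E +
    (3 / 4)%:E * U (pos @^-1` A))%E.
Proof.
move=> mA; have mpA : measurable (pos @^-1` A : set O).
  exact: (preimage_measurable measurable_pos mA).
have mi : measurable_fun setT (fun x : R => (\1_A x)%:E : \bar R).
  by apply/measurable_EFinP; exact: measurable_indic.
have i0 x : (0 <= (\1_A x : R)%:E)%E by rewrite lee_fin.
have e (f : O -> R) : measurable (f @^-1` A : set O) ->
    (\int[U]_w (\1_A (f w))%:E = U (f @^-1` A))%E.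
  move=> mf; transitivity (\int[U]_w (\1_(f @^-1` A) w)%:E)%E; first by [].
  by rewrite integral_indic// setIT.
transitivity (\int[U]_w (\1_A (mixt bL bR w))%:E)%E.
  by rewrite e//; exact: (preimage_measurable measurable_mixt mA).
rewrite (integral_mixt mL mR dis UL UR mi i0) /mixtJ -(e pos mpA).
by congr (_ + _%:E * _)%E; field.
Qed.

Let unif_pos (a b : R) : -3 <= a -> a <= b -> b <= 3 ->
  U (pos @^-1` `[a, b]%classic) = ((b - a) / 6)%:E.
Proof.
move=> a3 ab b3.
have -> : pos @^-1` `[a, b]%classic = hd @^-1` `[(a + 3) / 6, (b + 3) / 6]%classic.
  apply/seteqP; split => w /=; rewrite !in_itv/= /pos; lra.
have := unif_half (measurable_itv `[(a + 3) / 6, (b + 3) / 6]) (@measurableT _ O).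
rewrite preimage_setT setIT probability_setT mule1 => ->.
rewrite unif_itv; [by congr EFin; field|lra..].
Qed.

Let F_itv (a b : R) : -4 < a -> b < 4 ->
  F `[a, b]%classic = ((3 / 4)%:E * U (pos @^-1` `[a, b]%classic))%E.
Proof.
move=> a4 b4; rewrite FE ?indicE; last exact: measurable_itv.
by rewrite !memNset ?mule0 ?add0e//= in_itv/=; lra.
Qed.

Let cdfE (x : R) : -3 <= x <= 3 -> cdf_of F x = 2^-1 + (x - m) / 8.
Proof.
move=> /andP[x3 x3']; rewrite /cdf_of FE ?indicE; last exact: measurable_itv.
rewrite mem_set; last by rewrite /= in_itv/=; lra.
rewrite memNset; last by rewrite /= in_itv/=; lra.
have -> : pos @^-1` `]-oo, x]%classic = pos @^-1` `[-3, x]%classic.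
  by apply/seteqP; split => w /=; rewrite !in_itv/=; have := pos_bounds w; lra.
rewrite unif_pos ?lexx// mule1 mule0 adde0 -EFinM -EFinD /=.
by field.
Qed.

Let cdf_mono (x y : R) : x <= y -> cdf_of F x <= cdf_of F y.
Proof.
move=> xy; rewrite /cdf_of fine_le ?fin_num_measure//.
apply: le_measure; rewrite ?inE; [exact: measurable_itv..|].
by move=> z /=; rewrite !in_itv/= => /le_trans; exact.
Qed.

Let inf_eq (S : set R) (q : R) :
  (forall x, S x -> q <= x) -> (forall x, q < x -> S x) -> inf S = q.
Proof.
move=> lb ub; have lbS : lbound S q by exact: lb.
have S1 : S (q + 1) by apply: ub; rewrite ltrDl.
apply/eqP; rewrite eq_le; apply/andP; split; last first.
  by apply: lb_le_inf => //; exists (q + 1).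
apply/ler_addgt0Pr => e e0; apply: ge_inf; first by exists q.
by apply: ub; rewrite ltrDl.
Qed.

Let QLE (p : R) : -3 < m + 8 * (p - 2^-1) < 3 ->
  QL (cdf_of F) p = m + 8 * (p - 2^-1).
Proof.
set q := m + _ => /andP[q3 q3'].
have Fq : cdf_of F q = p by rewrite cdfE ?ltW// /q; field.
apply: inf_eq => x /=; last by move=> /ltW /cdf_mono; rewrite Fq.
move=> px; rewrite leNgt; apply/negP => xq.
have [x3|x3] := leP (-3) x.
  by move: px; rewrite cdfE; [move: xq; rewrite /q; lra|rewrite x3 ltW// (lt_trans xq)].
have := cdf_mono (ltW x3); rewrite (@cdfE (-3)); last lra.
by move: px q3; rewrite /q; lra.
Qed.

Let QRE (p : R) : -3 < m + 8 * (p - 2^-1) < 3 ->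
  QR (cdf_of F) p = m + 8 * (p - 2^-1).
Proof.
set q := m + _ => /andP[q3 q3'].
have Fq : cdf_of F q = p by rewrite cdfE ?ltW// /q; field.
apply: inf_eq => x /=.
  move=> px; rewrite leNgt; apply/negP => /ltW/cdf_mono.
  by rewrite Fq leNgt px.
move=> qx; have [x3|x3] := leP x 3.
  by rewrite cdfE ?x3 ?andbT; [move: qx; rewrite /q; lra|lra].
apply: lt_le_trans (cdf_mono (ltW x3)).
by rewrite cdfE; [move: q3'; rewrite /q; lra|lra].
Qed.

Let mb : -9 / 10 <= m <= 9 / 10.
Proof. by move: m1b; rewrite ler_norml; lra. Qed.

Lemma m1_clipped : m1 F = m.
Proof. by rewrite /m1 QLE subrr mulr0 addr0//; move: mb; lra. Qed.

Let absdevE (x : R) : 0 <= x <= 2 -> absdev_cdf F x = x / 4.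
Proof.
move=> x02; rewrite /absdev_cdf m1_clipped.
have -> : [set y : R | `|y - m| <= x] = `[m - x, m + x]%classic.
  by apply/seteqP; split => y /=; rewrite in_itv/= ler_norml; lra.
(* Since the median is at most 9/10 in absolute value and [x <= 2], the interval stays inside
   [[-3, 3]] and sees only the density. *)
have hm := mb; rewrite F_itv; [|lra..].
by rewrite unif_pos; [rewrite -EFinM/=; field|lra..].
Qed.

Lemma m2_clipped : m2 F = 2.
Proof.
apply: inf_eq => x /=.
  move=> hx; rewrite leNgt; apply/negP => x2.
  have [x0|x0] := leP 0 x; first by move: hx; rewrite absdevE; lra.
  move: hx; rewrite /absdev_cdf (_ : [set _ | _] = set0) ?measure0/=; first lra.
  by apply/seteqP; split => y //=; have := normr_ge0 (y - m1 F); lra.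
move=> x2; have A2 : absdev_cdf F 2 = 2^-1 by rewrite absdevE; [field|lra].
rewrite -A2 /absdev_cdf.
have mA z : measurable ([set y : R | `|y - m1 F| <= z] : set O).
  have -> : [set y : R | `|y - m1 F| <= z] = `[m1 F - z, m1 F + z]%classic.
    by apply/seteqP; split => y /=; rewrite in_itv/= ler_norml; lra.
  exact: measurable_itv.
rewrite fine_le ?fin_num_measure//.
by apply: le_measure; rewrite ?inE// => y /=; move=> /le_trans; apply; exact: ltW.
Qed.

(** The quantiles concerned are [m - 8 * tbar] and [m + 8 * tbar], at most 17/10 in absolute value,
    hence in the range where the cdf is affine. *)
Lemma in_family_clipped (tbar : R) : 0 < tbar < 1 / 10 -> in_family tbar 4 F.
Proof.
move=> tb; have := mb => hm; split.
- by rewrite /unique_median QLE ?QRE//; lra.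
- by rewrite m2_clipped.
rewrite m2_clipped QLE ?QRE; [|lra..].
move=> x1 x2 h1 h2; rewrite !cdfE; [|lra..].
rewrite (_ : 2^-1 + (x1 - m) / 8 - _ = (4 * 2)^-1 * (x1 - x2)); last by field.
by rewrite normrM (ger0_norm (_ : 0 <= (4 * 2)^-1)).
Qed.

End clipped_law.

End mixture.

(** * The contaminated instances *)

Section hard_instance.
Variable R : realType.
Local Notation U := (@unif R).
Local Notation O := (measurableTypeR R).
Local Notation hd := (half true : O -> O).
Local Notation tl := (half false : O -> O).

Let mhd : measurable_fun setT hd := @measurable_half R true.
Let mtl : measurable_fun setT tl := @measurable_half R false.

(** The two atoms occupy opposite ends of the selecting uniform variable, so they are disjoint and a
    malicious adversary can corrupt an extreme slice of one of them. Using [hd y] rather than [y]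
    leaves [tl y] free for an independent corruption coin. *)
Definition leftb (l : R) (y : O) : bool := hd y < l.
Definition rightb (r : R) (y : O) : bool := 1 - r <= hd y.

Lemma measurable_boolfun d (T : measurableType d) (f : T -> bool) :
  measurable [set x | f x] -> measurable_fun setT f.
Proof. by move=> mf; apply: (@measurable_fun_bool _ _ _ _ true); rewrite setTI. Qed.

Lemma measurable_boolset d (T : measurableType d) (f : T -> bool) :
  measurable_fun setT f -> measurable [set x | f x].
Proof. by move=> /(_ measurableT [set true]); rewrite setTI; exact. Qed.

Lemma measurable_ltb (a : R) : measurable_fun setT (fun y : O => y < a).
Proof.
apply: measurable_boolfun.
have -> : [set y : O | y < a] = `]-oo, a[%classic.
  by apply/seteqP; split => y /=; rewrite in_itv.
exact: measurable_itv.
Qed.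

Lemma measurable_leb (a : R) : measurable_fun setT (fun y : O => a <= y).
Proof.
apply: measurable_boolfun.
have -> : [set y : O | a <= y] = `[a, +oo[%classic.
  by apply/seteqP; split => y /=; rewrite in_itv/= andbT.
exact: measurable_itv.
Qed.

Lemma measurable_leftb l : measurable_fun setT (leftb l).
Proof. exact: (measurableT_comp (measurable_ltb l) mhd). Qed.

Lemma measurable_rightb r : measurable_fun setT (rightb r).
Proof. exact: (measurableT_comp (measurable_leb (1 - r)) mhd). Qed.

Lemma unif_hd (A : set O) : measurable A -> U (hd @^-1` A) = U A.
Proof.
move=> mA; have := unif_half mA (@measurableT _ O).
by rewrite preimage_setT setIT probability_setT mule1.
Qed.

Lemma unif_leftb l : 0 <= l <= 1 -> U [set y | leftb l y] = l%:E.
Proof.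
move=> l01; rewrite -(unif_ltb l01) -[RHS]unif_hd//.
exact: measurable_boolset (measurable_ltb l).
Qed.

Lemma unif_rightb r : 0 <= r <= 1 -> U [set y | rightb r y] = r%:E.
Proof.
move=> r01; rewrite -[in RHS](_ : 1 - (1 - r) = r); last by ring.
rewrite -unif_geb -1?[RHS]unif_hd//; last by lra.
exact: measurable_boolset (measurable_leb (1 - r)).
Qed.

Lemma unif_hd_itv (a b : R) : 0 <= a -> a <= b -> b <= 1 ->
  U [set y | a <= hd y < b] = (b - a)%:E.
Proof.
move=> a0 ab b1; rewrite -(unif_itv true true a0 ab b1) -[RHS]unif_hd.
  by congr (U _); apply/seteqP; split => y /=; rewrite in_itv.
exact: measurable_itv.
Qed.

Lemma probability_negb (f : O -> bool) (p : R) : measurable_fun setT f ->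
  U [set y | f y] = p%:E -> U [set y | ~~ f y] = (1 - p)%:E.
Proof.
move=> mf fp; rewrite EFinB -fp -(probability_setC U (measurable_boolset mf)).
by congr (U _); apply/seteqP; split => y /= /negP.
Qed.

Lemma unif_hd_outer (a b : R) : 0 <= a -> a <= b -> b <= 1 ->
  U [set y | (hd y < a) || (b <= hd y)] = (a + (1 - b))%:E.
Proof.
move=> a0 ab b1; rewrite (_ : a + (1 - b) = 1 - (b - a)); last by ring.
rewrite -(probability_negb _ (unif_hd_itv a0 ab b1)).
  congr (U _); apply/seteqP; split => y /=; rewrite negb_and -ltNge -leNgt//.
apply: measurable_and.
  exact: (measurableT_comp (measurable_leb a) mhd).
exact: (measurableT_comp (measurable_ltb b) mhd).
Qed.

Lemma unif_and_tl (f g : O -> bool) (p q : R) :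
  measurable_fun setT f -> measurable_fun setT g ->
  U [set y | f y] = p%:E -> U [set y | g y] = q%:E ->
  U [set y | g (tl y) && f (hd y)] = (q * p)%:E.
Proof.
move=> mf mg fp gq; rewrite mulrC EFinM -fp -gq.
rewrite -(unif_half (measurable_boolset mf) (measurable_boolset mg)).
congr (U _); apply/seteqP; split => y /=; first by move=> /andP[].
by move=> [fy gy]; apply/andP.
Qed.

Lemma integral_indic_preimage d (S : measurableType d) (f : O -> S) (A : set S) :
  measurable_fun setT f -> measurable A ->
  (\int[U]_w (\1_A (f w))%:E = U (f @^-1` A))%E.
Proof.
move=> mf mA; transitivity (\int[U]_w (\1_(f @^-1` A) w)%:E)%E; first by [].
by rewrite integral_indic ?setIT//; exact: preimage_measurable.
Qed.

(** The variables [hd w], [hd (tl w)] and [tl (tl w)] are three independent uniforms; the first two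
    make up the clean value, the third the corruption coin. *)
Lemma independent2_split d d' (S : measurableType d) (S' : measurableType d')
    (s : O * O -> S) (t : O -> S') :
  measurable_fun setT s -> measurable_fun setT t ->
  independent2 U (fun w => s (hd w, hd (tl w))) (fun w => t (tl (tl w))).
Proof.
move=> ms mt A B mA mB.
have mhtl : measurable_fun setT (fun w : O => hd (tl w)).
  exact: (measurableT_comp mhd mtl).
have mttl : measurable_fun setT (fun w : O => tl (tl w)).
  exact: (measurableT_comp mtl mtl).
have msw : measurable_fun setT (fun w : O => s (hd w, hd (tl w))).
  by apply: (measurableT_comp ms); apply/measurable_fun_pairP; split.
have mtw : measurable_fun setT (fun w : O => t (tl (tl w))).
  exact: (measurableT_comp mt mttl).
have mpair x : measurable_fun setT (fun y : O => (x, y) : O * O).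
  by apply/measurable_fun_pairP; split; [exact: measurable_cst|exact: measurable_id].
have mA1 : measurable_fun setT (fun q : O * O => (\1_A (s q))%:E : \bar R).
  have mi : measurable_fun setT (\1_A : S -> R) by exact: measurable_indic.
  by apply/measurable_EFinP; exact: (measurableT_comp mi ms).
have mA2 : measurable_fun setT (fun q : O * O => (\1_A (s (q.1, hd q.2)))%:E : \bar R).
  apply: (measurableT_comp mA1); apply/measurable_fun_pairP; split.
    exact: measurable_fst.
  exact: (measurableT_comp mhd measurable_snd).
have mB1 : measurable_fun setT (fun z : O => (\1_B (t z))%:E : \bar R).
  have mi : measurable_fun setT (\1_B : S' -> R) by exact: measurable_indic.
  by apply/measurable_EFinP; exact: (measurableT_comp mi mt).
have A0 q : (0 <= (\1_A (s q) : R)%:E)%E by rewrite lee_fin.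
have B0 z : (0 <= (\1_B (t z) : R)%:E)%E by rewrite lee_fin.
have YE : (U ((fun w : O => s (hd w, hd (tl w))) @^-1` A) =
    \int[U]_x \int[U]_y (\1_A (s (x, y)))%:E)%E.
  rewrite -(integral_indic_preimage msw mA).
  rewrite (integral_split mhd mtl (@splitting_half R) mA2)//.
  apply: eq_integral => x _.
  apply: (integral_head mhd mtl (@splitting_half R)
    (G := fun y => (\1_A (s (x, y)))%:E)%E) => //.
  exact: (measurableT_comp mA1 (mpair x)).
have DE : (U ((fun w : O => t (tl (tl w))) @^-1` B) =
    \int[U]_z (\1_B (t z))%:E)%E.
  rewrite (integral_indic_preimage mt mB).
  have tlE (C : set O) : measurable C -> U (tl @^-1` C) = U C.
    move=> mC; have := unif_half (@measurableT _ O) mC.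
    by rewrite preimage_setT setTI probability_setT mul1e.
  have mtB := preimage_measurable mt mB.
  by rewrite -[LHS]/(U (tl @^-1` (tl @^-1` (t @^-1` B)))) !tlE//;
    exact: preimage_measurable.
have c0 : (0 <= U ((fun w : O => t (tl (tl w))) @^-1` B))%E by [].
rewrite YE.
transitivity (\int[U]_w ((\1_A (s (hd w, hd (tl w))))%:E *
    (\1_B (t (tl (tl w))))%:E))%E.
  have mYD : measurable ((fun w : O => s (hd w, hd (tl w))) @^-1` A `&`
      (fun w : O => t (tl (tl w))) @^-1` B : set O).
    by apply: measurableI; exact: preimage_measurable.
  rewrite -[X in U X]setIT -(integral_indic U measurableT mYD).
  by apply: eq_integral => w _; rewrite indicI EFinM.
rewrite (integral_split mhd mtl (@splitting_half R)
  (F := fun q => ((\1_A (s (q.1, hd q.2)))%:E * (\1_B (t (tl q.2)))%:E)%E)); last 2 first.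
- apply: emeasurable_funM => //.
  exact: (measurableT_comp mB1 (measurableT_comp mtl measurable_snd)).
- by move=> q; rewrite mule_ge0.
have mI : measurable_fun setT (fun x => \int[U]_y (\1_A (s (x, y)))%:E)%E.
  exact: (measurable_fun_fubini_tonelli_F (m2 := U) (fun q : O * O => (\1_A (s q))%:E)).
rewrite muleC -ge0_integralZl//; last by move=> x _; exact: integral_ge0.
apply: eq_integral => x _ /=.
have mAx : measurable_fun setT (fun y : O => (\1_A (s (x, y)))%:E : \bar R).
  exact: (measurableT_comp mA1 (mpair x)).
rewrite (integral_split mhd mtl (@splitting_half R)
  (F := fun q => ((\1_A (s (x, q.1)))%:E * (\1_B (t q.2))%:E)%E)); last 2 first.
- apply: emeasurable_funM.
    exact: (measurableT_comp mAx measurable_fst).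
  exact: (measurableT_comp mB1 measurable_snd).
- by move=> q; rewrite mule_ge0.
rewrite -ge0_integralZl//; apply: eq_integral => y _ /=.
by rewrite ge0_integralZl// DE muleC.
Qed.

Variables (adv : adversary) (eps : R).
Hypothesis eps_bound : 0 < eps < 1 / 15.

(** The unavoidable uncertainty for [B = 4] and [m2 = 2], common to all arms. *)
Definition shift : R :=
  if adv is Malicious then 8 * eps else 4 * eps / (1 - eps).

(* Weight of the clean part that remains visible in the observed law: a
   malicious adversary only moves mass between the two atoms. *)
Definition eta : R := if adv is Malicious then 1 else 1 - eps.

(** Without malice, contamination puts [eps] on one atom, while the shifted clean median moves
    [(1 - eps) * shift / 8 = eps / 2] from that atom to the other. Both atoms end up with an extra
    [eps / 2], whatever the direction. *)
Definition obs_left (theta : R) : R := eta * (1 - theta) / 8 + (1 - eta) / 2.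
Definition obs_right (theta : R) : R := eta * (1 + theta) / 8 + (1 - eta) / 2.

Definition true_median (up : bool) (theta : R) : R :=
  theta + (if up then shift else - shift).

(** The malicious coin selects a slice of mass [eps] inside the atom on the side of the shift, to be
    sent to the opposite atom; otherwise the coin is independent of the clean value. *)
Definition corrupt (up : bool) (y : O) : bool :=
  if adv is Malicious then (if up then rightb eps y else leftb eps y)
  else (tl y < eps).

Lemma measurable_corrupt up : measurable_fun setT (corrupt up).
Proof.
rewrite /corrupt; case: adv; case: up;
  by [exact: (measurableT_comp (measurable_ltb eps) mtl)
     |exact: measurable_rightb|exact: measurable_leftb].
Qed.

Lemma unif_corrupt up : U [set y | corrupt up y] = eps%:E.
Proof.
have e01 : 0 <= eps <= 1 by have := eps_bound; lra.
have ob : U [set y : O | tl y < eps] = eps%:E.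
  rewrite -[in RHS](unif_ltb e01).
  have := unif_half (@measurableT _ O) (measurable_boolset (measurable_ltb eps)).
  by rewrite preimage_setT setTI probability_setT mul1e => <-.
rewrite /corrupt; case: adv => //.
by case: up; [exact: unif_rightb|exact: unif_leftb].
Qed.

Lemma shift_bounds : 0 < shift <= 8 / 15.
Proof.
have eb := eps_bound; have e1 : 0 < 1 - eps by lra.
rewrite /shift; case: adv; last by lra.
  by rewrite divr_gt0//= ?ler_pdivrMr//; lra.
by rewrite divr_gt0//= ?ler_pdivrMr//; lra.
Qed.

Lemma eta_bounds : 14 / 15 <= eta <= 1.
Proof. by have eb := eps_bound; rewrite /eta; case: adv; lra. Qed.

Section one_arm.
Variables (up : bool) (theta : R).
Hypothesis theta_bound : - (1 / 3) <= theta <= 1 / 3.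
Let m := true_median up theta.
Let l := (1 - m) / 8.
Let r := (1 + m) / 8.

Definition clean (w : O) : R :=
  mixt (leftb ((1 - true_median up theta) / 8))
       (rightb ((1 + true_median up theta) / 8)) w.

Let m_bounds : -9 / 10 <= m <= 9 / 10.
Proof.
have tb := theta_bound; have := shift_bounds.
by rewrite /m /true_median; case: up; lra.
Qed.

Lemma norm_true_median : `|true_median up theta| <= 9 / 10.
Proof. by rewrite ler_norml; have := m_bounds; rewrite /m; lra. Qed.

Lemma leftb_rightb_disj y : ~~ (leftb l y && rightb r y).
Proof. by rewrite /leftb /rightb /l /r; apply/negP => /andP[]; lra. Qed.

(** The event that the observation is -4: when [up] holds the contamination value is -4 and enlarges
    this event, otherwise it is 4 and removes corrupted points from it. [corruptr] is the mirror
    image. *)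
Let corruptl (y : O) :=
  if up then corrupt up y || leftb l y else ~~ corrupt up y && leftb l y.
Let corruptr (y : O) :=
  if up then ~~ corrupt up y && rightb r y else corrupt up y || rightb r y.

Let measurable_corruptl : measurable_fun setT corruptl.
Proof.
rewrite /corruptl; case: up.
  by apply: measurable_or; [exact: measurable_corrupt|exact: measurable_leftb].
apply: measurable_and; last exact: measurable_leftb.
by apply: measurable_neg; exact: measurable_corrupt.
Qed.

Let measurable_corruptr : measurable_fun setT corruptr.
Proof.
rewrite /corruptr; case: up.
  apply: measurable_and; last exact: measurable_rightb.
  by apply: measurable_neg; exact: measurable_corrupt.
by apply: measurable_or; [exact: measurable_corrupt|exact: measurable_rightb].
Qed.

Let unif_clean_and (f : O -> bool) (p : R) : measurable_fun setT f ->
  U [set y | f y] = p%:E ->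
  U [set y : O | ~~ (tl y < eps) && f (hd y)] = ((1 - eps) * p)%:E.
Proof.
move=> mf fp; have e01 : 0 <= eps <= 1 by have := eps_bound; lra.
apply: (@unif_and_tl f (fun y => ~~ (y < eps))) => //.
  by apply: measurable_neg; exact: measurable_ltb.
by apply: probability_negb; [exact: measurable_ltb|exact: unif_ltb].
Qed.

Let unif_corrupt_or (f : O -> bool) (p : R) : measurable_fun setT f ->
  U [set y | f y] = p%:E ->
  U [set y : O | (tl y < eps) || f (hd y)] = (1 - (1 - eps) * (1 - p))%:E.
Proof.
move=> mf fp.
have mnf : measurable_fun setT (fun y => ~~ f y) by exact: measurable_neg.
have h := unif_clean_and mnf (probability_negb mf fp).
rewrite -(probability_negb _ h).
  by congr (U _); apply/seteqP; split => y /=; rewrite negb_and !negbK.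
apply: measurable_and; apply: measurable_neg.
  exact: (measurableT_comp (measurable_ltb eps) mtl).
exact: (measurableT_comp mf mhd).
Qed.

Let lr_bounds : (0 <= l <= 1) * (0 <= r <= 1).
Proof. by have mb := m_bounds; rewrite /l /r; split; lra. Qed.

Let obl_shift : eta = 1 - eps -> (1 - eps) * shift = 4 * eps.
Proof.
have eb := eps_bound; rewrite /shift /eta.
have e1 : 1 - eps != 0 by rewrite gt_eqF//; lra.
case: adv => // [_|_|]; [by field|by field|].
by move=> h; exfalso; move: eb => /andP[e0 _]; lra.
Qed.

Let unif_corruptl : U [set y | corruptl y] = (obs_left theta)%:E.
Proof.
have [hl hr] := lr_bounds; have eb := eps_bound; have tb := theta_bound.
have U1 := unif_corrupt_or (measurable_ltb l) (unif_ltb hl).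
have U2 := unif_clean_and (measurable_ltb l) (unif_ltb hl).
have obl : eta = 1 - eps -> U [set y : O | if up then (tl y < eps) || leftb l y
    else ~~ (tl y < eps) && leftb l y] = (obs_left theta)%:E.
  move=> etaE; have := obl_shift etaE; rewrite /obs_left etaE.
  case upE: up => sE; [rewrite [LHS]U1|rewrite [LHS]U2]; congr EFin;
    by rewrite /l /m /true_median upE; nra.
rewrite /corruptl /corrupt.
case advE: adv; [by apply: obl; rewrite /eta advE|by apply: obl; rewrite /eta advE|].
have lE : l = (1 - (theta + (if up then 8 * eps else - (8 * eps)))) / 8.
  by rewrite /l /m /true_median /shift advE.
rewrite /obs_left /eta advE; move: hl lE; case: up => hl lE.
  transitivity (U [set y | (hd y < l) || (1 - eps <= hd y)]).
    by congr (U _); apply/seteqP; split => y; rewrite /= orbC.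
  by rewrite unif_hd_outer; [congr EFin; rewrite lE; field|lra..].
transitivity (U [set y | eps <= hd y < l]).
  by congr (U _); apply/seteqP; split => y; rewrite /= /leftb -leNgt.
by rewrite unif_hd_itv; [congr EFin; rewrite lE; field|lra..].
Qed.

Let unif_corruptr : U [set y | corruptr y] = (obs_right theta)%:E.
Proof.
have [hl hr] := lr_bounds; have eb := eps_bound; have tb := theta_bound.
have r01 : 0 <= 1 - r <= 1 by lra.
have U1 := unif_corrupt_or (measurable_leb (1 - r)) (unif_geb r01).
have U2 := unif_clean_and (measurable_leb (1 - r)) (unif_geb r01).
have obl : eta = 1 - eps -> U [set y : O | if up then ~~ (tl y < eps) && rightb r y
    else (tl y < eps) || rightb r y] = (obs_right theta)%:E.
  move=> etaE; have := obl_shift etaE; rewrite /obs_right etaE.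
  case upE: up => sE; [rewrite [LHS]U2|rewrite [LHS]U1]; congr EFin;
    by rewrite /r /m /true_median upE; nra.
rewrite /corruptr /corrupt.
case advE: adv; [by apply: obl; rewrite /eta advE|by apply: obl; rewrite /eta advE|].
have rE : r = (1 + (theta + (if up then 8 * eps else - (8 * eps)))) / 8.
  by rewrite /r /m /true_median /shift advE.
rewrite /obs_right /eta advE; move: hr rE; case: up => hr rE.
  transitivity (U [set y | 1 - r <= hd y < 1 - eps]).
    by congr (U _); apply/seteqP; split => y; rewrite /= /rightb -ltNge andbC.
  by rewrite unif_hd_itv; [congr EFin; rewrite rE; field|lra..].
transitivity (U [set y | (hd y < eps) || (1 - r <= hd y)]); first by [].
by rewrite unif_hd_outer; [congr EFin; rewrite rE; field|lra..].
Qed.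

Definition observation (w : O) : R :=
  (1 - (corrupt up (tl w))%:R) * clean w +
  (corrupt up (tl w))%:R * (if up then -4 else 4).

(** The right side is free of [up]: an arm shifted up and an arm shifted down cannot be told apart
    from their observations. *)
Lemma integral_observation (h : R -> \bar R) :
  measurable_fun setT h -> (forall x, 0 <= h x)%E ->
  (\int[U]_w h (observation w) = mixtJ (obs_left theta) (obs_right theta) h)%E.
Proof.
move=> mh h0; rewrite -(integral_mixt measurable_corruptl measurable_corruptr _
  unif_corruptl unif_corruptr mh h0); last first.
  move=> y; have := leftb_rightb_disj y; rewrite /corruptl /corruptr.
  by case: up; case: (corrupt _ y); case: (leftb l y); case: (rightb r y).
apply: eq_integral => w _; congr h.
rewrite /observation /clean /mixt -/m -/l -/r /corruptl /corruptr.
have := leftb_rightb_disj (tl w).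
case: up; case: (corrupt _ (tl w)); case: (leftb l (tl w));
  case: (rightb r (tl w)) => //= _;
  by rewrite ?(subr0, subrr, mul1r, mul0r, addr0, add0r).
Qed.

End one_arm.

Section instance.
Variables (k : nat) (best : 'I_k) (theta : 'I_k -> R).
Hypothesis theta_bound : forall i, - (1 / 3) <= theta i <= 1 / 3.

Let up (i : 'I_k) := i == best.
Let m i := true_median (up i) (theta i).

Let yf (i : 'I_k) : O -> R := clean (up i) (theta i).
Let df (i : 'I_k) (w : O) : bool := corrupt (up i) (tl w).
Let zf (i : 'I_k) (w : O) : R := if up i then -4 else 4.

Let myf i : measurable_fun setT (yf i) :=
  measurable_mixt (measurable_leftb ((1 - m i) / 8))
    (measurable_rightb ((1 + m i) / 8)).

Let mdf i : measurable_fun setT (df i).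
Proof. exact: (measurableT_comp (measurable_corrupt (up i)) mtl). Qed.

Let mzf i : measurable_fun setT (zf i).
Proof. exact: measurable_cst. Qed.

Definition hard_instance : cbai_instance R k :=
  iid_instance U mhd mtl myf mzf mdf.

Let unif_bounds i :
  (0 <= (1 - m i) / 8 <= 1) * (0 <= (1 + m i) / 8 <= 1).
Proof.
by have := norm_true_median (up i) (theta_bound i); rewrite ler_norml /m; split; lra.
Qed.

Lemma m1_arm i : m1 (arm hard_instance i) = m i.
Proof.
have [hl hr] := unif_bounds i.
have h := m1_clipped (measurable_leftb _) (measurable_rightb _)
  (leftb_rightb_disj (up i) (theta i)) (unif_leftb hl) (unif_rightb hr)
  (norm_true_median (up i) (theta_bound i)).
exact: h.
Qed.

Lemma m2_arm i : m2 (arm hard_instance i) = 2.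
Proof.
have [hl hr] := unif_bounds i.
have h := m2_clipped (measurable_leftb _) (measurable_rightb _)
  (leftb_rightb_disj (up i) (theta i)) (unif_leftb hl) (unif_rightb hr)
  (norm_true_median (up i) (theta_bound i)).
exact: h.
Qed.

Lemma in_family_arm tbar i : 0 < tbar < 1 / 10 ->
  in_family tbar 4 (arm hard_instance i).
Proof.
have [hl hr] := unif_bounds i.
have h := in_family_clipped (measurable_leftb _) (measurable_rightb _)
  (leftb_rightb_disj (up i) (theta i)) (unif_leftb hl) (unif_rightb hr)
  (norm_true_median (up i) (theta_bound i)).
exact: h.
Qed.

Lemma uncertainty_arm i : uncertainty adv eps 4 (arm hard_instance i) = shift.
Proof.
have eb := eps_bound; have e1 : 1 - eps != 0 by rewrite gt_eqF//; lra.
by rewrite /uncertainty m2_arm /shift; case: adv; [field|field|ring].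
Qed.

Lemma effective_gap_hard i : i != best ->
  effective_gap adv eps 4 hard_instance best i = theta best - theta i.
Proof.
move=> ib; rewrite /effective_gap !m1_arm !uncertainty_arm /m /true_median /up.
by rewrite eqxx (negbTE ib); ring.
Qed.

(** The gap of the best arm to itself is minus twice [shift], so that outputting this arm meets the
    PAC criterion. *)
Lemma effective_gap_best :
  effective_gap adv eps 4 hard_instance best best <= 0.
Proof.
rewrite /effective_gap m1_arm uncertainty_arm.
by have := shift_bounds; lra.
Qed.

Lemma optimal_arm_hard : (forall i, i != best -> theta i <= theta best) ->
  optimal_arm hard_instance best.
Proof.
move=> tb j jb; rewrite !m1_arm /m /true_median /up eqxx (negbTE jb).
by have := tb _ jb; have := shift_bounds; lra.
Qed.

Lemma bernoulli_boolfun (f : O -> bool) (p : R) : 0 <= p <= 1 ->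
  measurable_fun setT f -> U [set y | f y] = p%:E ->
  forall A : set bool, U (f @^-1` A) = bernoulli_prob p A.
Proof.
move=> p01 mf fp A; rewrite bernoulli_probE// !diracE.
have fn := probability_negb mf fp.
have [t|t] := boolP (true \in A); have [n|n] := boolP (false \in A).
- rewrite (_ : _ @^-1` _ = setT) ?probability_setT; last first.
    by apply/seteqP; split => y //= _; case: (f y); exact/set_mem.
  by rewrite !mule1 -EFinD; congr EFin; rewrite addrC; exact/esym/subrK.
- rewrite (_ : _ @^-1` _ = [set y | f y]) ?fp ?mule1 ?mule0 ?adde0//.
  apply/seteqP; split => y /=; case: (f y) => //; last by move=> _; exact/set_mem.
  by move=> /mem_set; rewrite (negbTE n).
- rewrite (_ : _ @^-1` _ = [set y | ~~ f y]) ?fn ?mule1 ?mule0 ?add0e//.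
  apply/seteqP; split => y /=; case: (f y) => //; last by move=> _; exact/set_mem.
  by move=> /mem_set; rewrite (negbTE t).
- rewrite (_ : _ @^-1` _ = set0) ?measure0 ?mule0 ?adde0//.
  apply/seteqP; split => y //=; case: (f y) => /mem_set.
    by rewrite (negbTE t).
  by rewrite (negbTE n).
Qed.

Let mxi t : measurable_fun setT (xi hd tl t) := measurable_xi mhd mtl t.

Let probability_xi t (A : set O) : measurable A -> U (xi hd tl t @^-1` A) = U A.
Proof. exact: (probability_xi mhd mtl (@splitting_half R)). Qed.

Let indep_clean_corrupt i : adv <> Malicious ->
  independent2 U (yf i) (df i).
Proof.
move=> advE.
pose s (q : O * O) : R := if q.2 < (1 - m i) / 8 then -4
  else if 1 - (1 + m i) / 8 <= q.2 then 4 else 6 * q.1 - 3.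
have ms : measurable_fun setT s.
  apply: measurable_fun_ifT => //.
    exact: (measurableT_comp (measurable_ltb _) measurable_snd).
  apply: measurable_fun_ifT => //.
    exact: (measurableT_comp (measurable_leb _) measurable_snd).
  by apply: measurable_funB => //; apply: measurable_funM => //; exact: measurable_fst.
have := independent2_split ms (measurable_ltb eps).
by rewrite /df /corrupt; case: adv advE.
Qed.

Let indep_xi i t : independent2 U (yf i) (df i) ->
  independent2 U (Y_ hard_instance i t) (D_ hard_instance i t).
Proof.
move=> ind A B mA mB.
have my : measurable (yf i @^-1` A) := preimage_measurable (myf i) mA.
have md : measurable (df i @^-1` B) := preimage_measurable (mdf i) mB.
have := ind A B mA mB; rewrite -(probability_xi t my) -(probability_xi t md).
by rewrite -(probability_xi t (measurableI _ _ my md)).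
Qed.

Lemma legal_hard : legal adv eps hard_instance.
Proof.
have eb := eps_bound.
split.
  move=> i t; split => [A mA|A].
    exact: (probability_xi t (preimage_measurable (myf i) mA)).
  rewrite -(bernoulli_boolfun _ (mdf i)).
  - exact: (probability_xi t (preimage_measurable (mdf i) _)).
  - lra.
  - rewrite -(unif_corrupt (up i)).
    have := unif_half (@measurableT _ O) (measurable_boolset (measurable_corrupt (up i))).
    by rewrite preimage_setT setTI probability_setT mul1e => <-.
have mW2 i : measurable_fun setT (fun w => (yf i w, df i w)).
  by apply/measurable_fun_pairP; split; [exact: myf|exact: mdf].
have mW3 i : measurable_fun setT (fun w => (yf i w, df i w, zf i w)).
  by apply/measurable_fun_pairP; split; [exact: mW2|exact: mzf].
case advE: adv => i.
- split; first exact: (independent_seq_xi mhd mtl (@splitting_half R) (mW3 i)).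
  by move=> t; apply: indep_xi; apply: indep_clean_corrupt; rewrite advE.
- split; first exact: (independent_seq_xi mhd mtl (@splitting_half R) (mW2 i)).
  by move=> t; apply: indep_xi; apply: indep_clean_corrupt; rewrite advE.
- exact: (independent_seq_xi mhd mtl (@splitting_half R) (mW2 i)).
Qed.

End instance.

End hard_instance.

(** * Numerical bounds on logarithms *)

Section numeric.
Variable R : realType.

Lemma ln_le_sub1 (x : R) : 0 < x -> ln x <= x - 1.
Proof. by move=> x0; have := expR_ge1Dx (ln x); rewrite lnK ?posrE//; lra. Qed.

(** Taking an approximate [n]-th root sharpens [ln y <= y - 1]. It is used with
    [2 <= (12 / 11) ^+ 8] and [3 / 20 <= (8 / 9) ^+ 16]. *)
Lemma ln_le_root (n : nat) (x y : R) : 0 < x -> 0 < y -> x <= y ^+ n ->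
  ln x <= n%:R * (y - 1).
Proof.
move=> x0 y0 xy; apply: (@le_trans _ _ (ln (y ^+ n))).
  by rewrite ler_ln ?posrE ?exprn_gt0.
by rewrite lnXn// -(mulr_natl (ln y)); apply: ler_wpM2l => //; exact: ln_le_sub1.
Qed.

Lemma ln2_le : ln 2 <= 8 / 11 :> R.
Proof.
apply: (@le_trans _ _ (8%:R * (12 / 11 - 1))); last by lra.
by apply: ln_le_root; lra.
Qed.

Lemma ln_inv_ge (delta : R) : 0 < delta < 3 / 20 -> 16 / 9 <= ln delta^-1.
Proof.
move=> /andP[d0 d1]; rewrite lnV ?posrE//.
have : ln delta <= 16%:R * (8 / 9 - 1); last by lra.
by apply: ln_le_root; lra.
Qed.

(** The bounds 8/11 on [ln 2] and 16/9 on [ln delta^-1] suffice with a margin below 1/100. *)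
Lemma ln_bound (delta : R) : 0 < delta < 3 / 20 ->
  ln delta^-1 / 200 <= 49 / 100 * ln (2 * delta)^-1 - 1 / 2.
Proof.
move=> d; have /andP[d0 d1] := d; have := ln_inv_ge d; have := ln2_le.
by rewrite !lnV ?posrE ?mulr_gt0// lnM ?posrE//; lra.
Qed.

End numeric.

(** * Likelihood ratio and divergence of two observed laws *)

Section likelihood_ratio.
Variable R : realType.
Local Notation U := (@unif R).
Local Notation O := (measurableTypeR R).
Variables (adv : adversary) (eps : R).
Hypothesis eps_bound : 0 < eps < 1 / 15.
Variables (th th' : R).
Hypothesis th_bound : - (1 / 3) <= th <= 1 / 3.
Hypothesis th'_bound : - (1 / 3) <= th' <= 1 / 3.

Let l := obs_left adv eps th.
Let r := obs_right adv eps th.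
Let l' := obs_left adv eps th'.
Let r' := obs_right adv eps th'.
Let s := eta adv eps * (th' - th) / 8.

Let eb : 14 / 15 <= eta adv eps <= 1.
Proof. exact: eta_bounds. Qed.

Let l_ge : 1 / 12 <= l.
Proof. by have := eb; have := th_bound; rewrite /l /obs_left; nra. Qed.

Let r_ge : 1 / 12 <= r.
Proof. by have := eb; have := th_bound; rewrite /r /obs_right; nra. Qed.

Let l'_ge : 1 / 12 <= l'.
Proof. by have := eb; have := th'_bound; rewrite /l' /obs_left; nra. Qed.

Let r'_ge : 1 / 12 <= r'.
Proof. by have := eb; have := th'_bound; rewrite /r' /obs_right; nra. Qed.

Let l'E : l' = l - s. Proof. by rewrite /l' /l /s /obs_left; field. Qed.
Let r'E : r' = r + s. Proof. by rewrite /r' /r /s /obs_right; field. Qed.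

Definition loglik (x : R) : R :=
  if x == -4 then ln (l' / l) else if x == 4 then ln (r' / r) else 0.

Lemma measurable_loglik : measurable_fun setT loglik.
Proof.
have me (a : R) : measurable_fun setT (fun x : R => x == a).
  apply: measurable_boolfun; rewrite (_ : [set _ | _] = [set a]).
    exact: measurable_set1.
  by apply/seteqP; split => x /=; [move/eqP|move=> ->].
apply: measurable_fun_ifT => //; exact: measurable_fun_ifT.
Qed.

Let loglikL : loglik (-4) = ln (l' / l).
Proof. by rewrite /loglik eqxx. Qed.

Let loglikR : loglik 4 = ln (r' / r).
Proof. by rewrite /loglik eqxx; case: eqP => // h; exfalso; lra. Qed.

Let loglik_pos w : loglik (pos w) = 0.
Proof.
rewrite /loglik; have := pos_bounds w.
by case: eqP => [->|_]; [lra|case: eqP => [->|_] //; lra].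
Qed.

Let ll'_gt0 : 0 < l' / l.
Proof. by rewrite divr_gt0; have := l_ge; have := l'_ge; lra. Qed.

Let rr'_gt0 : 0 < r' / r.
Proof. by rewrite divr_gt0; have := r_ge; have := r'_ge; lra. Qed.

(** Changing the observed median moves mass [s] from one atom to the other and leaves the continuous
    part intact, so the density differs from 1 at the atoms only. *)
Lemma mixtJ_loglik (h : R -> \bar R) : (forall x, 0 <= h x)%E ->
  mixtJ l' r' h = mixtJ l r (fun x => h x * (expR (loglik x))%:E)%E.
Proof.
move=> h0; rewrite /mixtJ loglikL loglikR !lnK ?posrE//.
under [in RHS]eq_integral do rewrite loglik_pos expR0 mule1.
have l0 : l != 0 by rewrite gt_eqF//; have := l_ge; lra.
have r0 : r != 0 by rewrite gt_eqF//; have := r_ge; lra.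
rewrite (muleC (h (-4)) _) (muleC (h 4) _) !muleA -!EFinM.
rewrite (mulrC l) (mulrC r) !divfK//.
by congr (_ + _%:E * _)%E; rewrite l'E r'E; ring.
Qed.

(** Because [l' + r' = l + r], the exponential terms cancel and the excess over [Phi L] is the
    Kullback-Leibler divergence. It is bounded by the chi-square expression
    [s ^+ 2 * (l'^-1 + r'^-1)]. *)
Lemma mixtJ_Phi L :
  (mixtJ l r (fun x => (Phi (L + loglik x))%:E) <=
   (Phi L + (th' - th) ^+ 2)%:E)%E.
Proof.
rewrite /mixtJ loglikL loglikR.
under eq_integral do rewrite loglik_pos addr0.
rewrite integral_cst// -[X in (_ * (_ * X))%E]/(U setT) probability_setT mule1.
rewrite -!EFinM -!EFinD lee_fin /Phi !expRD !lnK ?posrE//.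
have key (a b : R) : 1 / 12 <= a -> 1 / 12 <= b ->
    - (a * ln (b / a)) <= a * ((a - b) / b).
  move=> a12 b12; have a0 : 0 < a by lra.
  have b0 : 0 < b by lra.
  rewrite -mulrN ler_pM2l// -lnV ?posrE ?divr_gt0// invf_div.
  rewrite mulrBl mulfV ?gt_eqF//; apply: ln_le_sub1; exact: divr_gt0.
have kl := key _ _ l_ge l'_ge; have kr := key _ _ r_ge r'_ge.
have l0 : l != 0 by rewrite gt_eqF//; have := l_ge; lra.
have r0 : r != 0 by rewrite gt_eqF//; have := r_ge; lra.
have il' : l'^-1 <= 12 by rewrite -[leRHS]invrK lef_pV2 ?posrE; have := l'_ge; lra.
have ir' : r'^-1 <= 12 by rewrite -[leRHS]invrK lef_pV2 ?posrE; have := r'_ge; lra.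
have klE : l * ((l - l') / l') + r * ((r - r') / r') = s ^+ 2 * (l'^-1 + r'^-1).
  have l'0 : l' != 0 by rewrite gt_eqF//; have := l'_ge; lra.
  have r'0 : r' != 0 by rewrite gt_eqF//; have := r'_ge; lra.
  have -> : l = l' + s by rewrite l'E; ring.
  have -> : r = r' - s by rewrite r'E; ring.
  by field; rewrite l'0 r'0.
have klle : s ^+ 2 * (l'^-1 + r'^-1) <= (th' - th) ^+ 2.
  (* Atoms weigh at least 1/12, so the inverses sum to at most 24, and [s ^+ 2] carries a factor
     1/64. *)
  apply: (@le_trans _ _ (s ^+ 2 * 24)).
    by apply: ler_wpM2l; [exact: sqr_ge0|lra].
  have e1 : eta adv eps ^+ 2 <= 1 by rewrite expr_le1//; have := eb; lra.
  have := sqr_ge0 (th' - th); rewrite /s !exprMn; nra.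
have E : l * (expR L * (l' / l)) = expR L * l'.
  by field; rewrite l0.
have E' : r * (expR L * (r' / r)) = expR L * r'.
  by field; rewrite r0.
have S : l' + r' = l + r by rewrite l'E r'E; ring.
move: kl kr klE klle; move: (ln (l' / l)) (ln (r' / r)) => a b kl kr klE klle.
have -> : l * (expR L * (l' / l) - 1 - (L + a)) +
  r * (expR L * (r' / r) - 1 - (L + b)) +
  (1 - l - r) * (expR L - 1 - L) =
  expR L - 1 - L + (- (l * a) - (r * b)) + expR L * (l' + r' - (l + r)).
  by rewrite !mulrBr E E'; ring.
by rewrite S subrr mulr0 addr0; lra.
Qed.

End likelihood_ratio.

(** * The lower bound *)

Section lower_bound.
Variable R : realType.
Local Notation U := (@unif R).
Local Notation O := (measurableTypeR R).
Local Notation hd := (half true : O -> O).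
Local Notation tl := (half false : O -> O).

Let mhd : measurable_fun setT hd := @measurable_half R true.
Let mtl : measurable_fun setT tl := @measurable_half R false.

Variables (adv : adversary) (eps : R).
Hypothesis eps_bound : 0 < eps < 1 / 15.
Variables (k : nat) (alg : algorithm R k).

Definition obs_of (best : 'I_k) (theta : 'I_k -> R) (i : 'I_k) (w : O) : R :=
  observation adv eps (i == best) (theta i) w.

Local Notation S := (seed alg).
Local Notation PQ := (U \x seed_prob alg)%E.
Local Notation st b th n z := (@state R _ O hd tl k alg (obs_of b th) n z).
Local Notation N b th j n :=
  (\int[PQ]_z (wsum (@active R k alg j) (cst 1) (st b th n z))%:E)%E.
Local Notation err b th j n :=
  (\sum_(t < n.+1) \int[PQ]_z (errs j (st b th t z))%:E)%E.

Section instances.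
Variables (best : 'I_k) (theta : 'I_k -> R).
Hypothesis theta_bound : forall i, - (1 / 3) <= theta i <= 1 / 3.
Local Notation I := (hard_instance adv eps best theta).

Lemma measurable_obs_of i : measurable_fun setT (obs_of best theta i).
Proof.
exact: (@measurable_obs_fun R _ O k
  (fun i => clean adv eps (i == best) (theta i))
  (fun i w => if i == best then -4 else 4)
  (fun i w => corrupt adv eps (i == best) (tl w))
  (fun i => measurable_mixt (measurable_leftb _) (measurable_rightb _))
  (fun i => measurable_cst _)
  (fun i => measurableT_comp (measurable_corrupt adv eps (i == best)) mtl) i).
Qed.

Lemma hard_mass (e : R) : as_finite alg I -> 0 < e ->
  exists n : nat, ((1 - e)%:E <=
    \sum_(t < n.+1) \int[PQ]_z (stopped (st best theta t z))%:E)%E.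
Proof. move=> fin e0; exact: (stopped_mass fin e0). Qed.

Lemma hard_err_pair i j n : i != j ->
  (\sum_(t < n.+1) \int[PQ]_z (stopped (st best theta t z))%:E <=
   err best theta i n + err best theta j n)%E.
Proof.
move=> ij.
have := @errs_pair R _ O U hd tl mhd mtl k
  (fun i => clean adv eps (i == best) (theta i))
  (fun i w => if i == best then -4 else 4)
  (fun i w => corrupt adv eps (i == best) (tl w))
  (fun i => measurable_mixt (measurable_leftb _) (measurable_rightb _))
  (fun i => measurable_cst _)
  (fun i => measurableT_comp (measurable_corrupt adv eps (i == best)) mtl) alg i j n ij.
exact.
Qed.

Lemma hard_expected n j0 :
  (\sum_(j | j != j0) N best theta j n <= expected_sample_complexity alg I)%E.
Proof. exact: expected_count. Qed.

Lemma hard_err_le j n (delta : R) :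
  ((1 - delta)%:E <= PQ [set z : run_space alg I | outputs j z])%E ->
  (err best theta j n <= delta%:E)%E.
Proof. exact: errs_integral_le. Qed.

End instances.

(** The best arms [b] and [b'] are unrelated: they act on the true laws only, whereas the likelihood
    involves the observed medians, which differ at [j] alone. *)
Lemma hard_likelihood (b b' j : 'I_k) (th th' : 'I_k -> R) n a :
  (forall i, - (1 / 3) <= th i <= 1 / 3) ->
  (forall i, - (1 / 3) <= th' i <= 1 / 3) ->
  (forall i, i != j -> th' i = th i) -> 0 < a <= 1 ->
  ((ln a^-1)%:E * err b th j n <=
   ((th' j - th j) ^+ 2)%:E * N b th j n + (a^-1 - 1)%:E * err b' th' j n)%E.
Proof.
move=> thb thb' thE a01.
apply: (@likelihood_bound R _ O U hd tl mhd mtl (@splitting_half R) k alg j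
  (obs_of b th) (obs_of b' th') (loglik adv eps (th j) (th' j))) => //.
- exact: measurable_obs_of.
- exact: measurable_obs_of.
- exact: measurable_loglik.
- exact: sqr_ge0.
- move=> L; have := mixtJ_Phi adv eps_bound (thb j) (thb' j) L.
  rewrite -(integral_observation adv eps_bound (j == b) (thb j)
    (h := fun x => (Phi (L + loglik adv eps (th j) (th' j) x))%:E)) //.
    apply/measurable_EFinP; apply: (measurableT_comp (@measurable_Phi R)).
    by apply: measurable_funD => //; exact: measurable_loglik.
  by move=> x; rewrite lee_fin Phi_ge0.
- move=> i h ij mh h0.
  rewrite (integral_observation adv eps_bound _ (thb' i) mh h0) thE//.
  by rewrite (integral_observation adv eps_bound _ (thb i) mh h0).
- move=> h mh h0; rewrite (integral_observation adv eps_bound _ (thb' j) mh h0).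
  rewrite (mixtJ_loglik adv eps_bound (thb j) (thb' j) h0).
  rewrite -(integral_observation adv eps_bound (j == b) (thb j)
    (h := fun x => h x * (expR (loglik adv eps (th j) (th' j) x))%:E)%E) //.
    apply: emeasurable_funM => //; apply/measurable_EFinP.
    exact: (measurableT_comp (@measurable_expR R) (measurable_loglik _ _ _ _)).
  by move=> x; rewrite mule_ge0// lee_fin expR_ge0.
Qed.

End lower_bound.

Lemma count_bound (R : realType) (delta K D : R) (E N E' : \bar R) :
  0 < delta < 3 / 20 -> 0 <= K -> K <= 9 * D -> 0 < D ->
  ((49 / 100)%:E <= E)%E -> (E' <= delta%:E)%E -> (0 <= N)%E ->
  ((ln (2 * delta)^-1)%:E * E <= K%:E * N + ((2 * delta)^-1 - 1)%:E * E')%E ->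
  ((ln delta^-1 / 1800 / D)%:E <= N)%E.
Proof.
move=> hd K0 KD D0 hE hE' N0 h; have /andP[d0 d1] := hd.
have i1 : 1 <= (2 * delta)^-1 by rewrite invf_ge1; lra.
have l0 : 0 <= ln (2 * delta)^-1 by rewrite ln_ge0.
have h1 : ((49 / 100 * ln (2 * delta)^-1)%:E <= K%:E * N + (1 / 2 - delta)%:E)%E.
  rewrite mulrC EFinM; apply: le_trans (lee_wpmul2l _ hE) _; first by rewrite lee_fin.
  apply: le_trans h _; apply: leeD2l.
  (* This is the largest possible contribution of errors in the raised instance. *)
  have -> : 1 / 2 - delta = ((2 * delta)^-1 - 1) * delta.
    by field; rewrite gt_eqF.
  by rewrite EFinM; apply: lee_wpmul2l => //; rewrite lee_fin subr_ge0.
have h2 : ((ln delta^-1 / 200)%:E <= K%:E * N)%E.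
  apply: (@le_trans _ _ ((49 / 100 * ln (2 * delta)^-1) - (1 / 2 - delta))%:E).
    by rewrite lee_fin; have := ln_bound hd; lra.
  by rewrite EFinB leeBlDr.
have h3 : ((ln delta^-1 / 200)%:E <= (9 * D)%:E * N)%E.
  by apply: le_trans h2 _; apply: lee_wpmul2r => //; rewrite lee_fin.
have -> : ln delta^-1 / 1800 / D = (9 * D)^-1 * (ln delta^-1 / 200).
  by field; rewrite gt_eqF.
by rewrite EFinM lee_pdivrMl// mulr_gt0.
Qed.

(** * Consequences of the PAC guarantee *)

Section pac_bound.
Variable R : realType.
Variables (adv : adversary) (k : nat) (delta alpha eps tbar : R).
Variables (istar : 'I_k) (gap : 'I_k -> R).
Hypothesis delta_bound : 0 < delta < 3 / 20.
Hypothesis alpha_bound : 0 < alpha < 1 / 6.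
Hypothesis eps_bound : 0 < eps < 1 / 15.
Hypothesis tbar_bound : 0 < tbar < 1 / 10.
Hypothesis gap_bound : forall i : 'I_k, i != istar -> 0 < gap i < 1 / 3.

Let U := @unif R.

Definition obs_median (i : 'I_k) : R := if i == istar then 0 else - gap i.

(** The other medians are at most 0, so [2 * alpha] puts arm [j] ahead by more than [alpha]; it
    remains below 1/3 because [alpha < 1 / 6]. *)
Definition raised_median (j i : 'I_k) : R :=
  if i == j then 2 * alpha else obs_median i.

Lemma obs_median_bound i : - (1 / 3) <= obs_median i <= 1 / 3.
Proof.
rewrite /obs_median; case: ifPn => [_|/gap_bound]; lra.
Qed.

Lemma obs_median_le0 i : obs_median i <= 0.
Proof. by rewrite /obs_median; case: ifPn => [_|/gap_bound]; lra. Qed.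

Lemma raised_median_bound j i : - (1 / 3) <= raised_median j i <= 1 / 3.
Proof.
rewrite /raised_median; case: ifPn => _; last exact: obs_median_bound.
by have := alpha_bound; lra.
Qed.

Definition dist (i : 'I_k) : R := if i == istar then alpha else Num.max (gap i) alpha.

Lemma dist_gt0 i : 0 < dist i.
Proof.
have /andP[a0 _] := alpha_bound.
by rewrite /dist; case: ifP => // _; rewrite lt_max a0 orbT.
Qed.

Lemma dist_ge i : alpha <= dist i.
Proof. by rewrite /dist; case: ifP => // _; rewrite le_max lexx orbT. Qed.

(** The median is raised by [gap i + 2 * alpha], or by [2 * alpha] for the optimal arm, in both
    cases at most three times [dist i]. *)
Lemma raise_le i : (raised_median i i - obs_median i) ^+ 2 <= 9 * dist i ^+ 2.
Proof.
have /andP[a0 _] := alpha_bound; have d0 := dist_gt0 i; have da := dist_ge i.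
have dg : i != istar -> gap i <= dist i.
  by move=> ii; rewrite /dist (negbTE ii) le_max lexx.
have h : 0 <= raised_median i i - obs_median i <= 3 * dist i.
  rewrite /raised_median eqxx /obs_median; case: ifPn => [_|ii]; first lra.
  by have := dg ii; have := gap_bound ii; lra.
by move: h => /andP[h0 h1]; nra.
Qed.

Local Notation I := (hard_instance adv eps istar obs_median).

Lemma admissible_hard best th : (forall i : 'I_k, - (1 / 3) <= th i <= 1 / 3) ->
  admissible adv eps tbar 4 (hard_instance adv eps best th).
Proof.
move=> thb; split; first exact: legal_hard.
by move=> i; exact: in_family_arm.
Qed.

Variable alg : algorithm R k.
Hypothesis alg_pac : PAC adv eps tbar 4 alpha delta alg.

Lemma pac_raised j :
  ((1 - delta)%:E <= (U \x seed_prob alg)%E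
     [set z : run_space alg (hard_instance adv eps j (raised_median j)) |
       outputs j z])%E.
Proof.
have thb := raised_median_bound j; have /andP[a0 _] := alpha_bound.
have [_ /(_ j)] := alg_pac (admissible_hard j thb).
have jopt : optimal_arm (hard_instance adv eps j (raised_median j)) j.
  apply: optimal_arm_hard => // i ij.
  by rewrite /raised_median (negbTE ij) eqxx; have := obs_median_le0 i; lra.
move=> /(_ jopt); rewrite /run_prob.
congr (_ <= _)%E; congr (_ _); apply/seteqP; split => z /=; last first.
  move=> jz; exists j => //.
  by apply: le_trans (effective_gap_best _ _ _ _) (ltW a0).
move=> [i iz]; have [ijE|ij] := eqVneq i j; first by move: iz; rewrite ijE.
have -> := effective_gap_hard adv eps_bound thb ij.
rewrite /raised_median eqxx (negbTE ij).
by have := obs_median_le0 i; lra.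
Qed.

Lemma pac_expected :
  ((1 / 1800 * (\sum_(i < k | i != istar) (Num.max (gap i) alpha ^+ 2)^-1
       * ln (delta^-1)))%:E <= expected_sample_complexity alg I)%E.
Proof.
have /andP[d0 d1] := delta_bound; have /andP[a0 a1] := alpha_bound.
have [fin _] := alg_pac (admissible_hard istar obs_median_bound).
have [//|n hn] := hard_mass fin (_ : 0 < 1 / 50 :> R).
set q := (\sum_(t < n.+1) _)%E in hn.
pose e j := (\sum_(t < n.+1) \int[U \x seed_prob alg]_z
  (errs j (state (half true) (half false) (obs_of adv eps istar obs_median) t z))%:E)%E.
pose w := ln delta^-1 / 1800.
have w0 : 0 <= w.
  apply: divr_ge0; last exact: ler0n.
  by rewrite ln_ge0// invf_ge1//; lra.
have bound j : ((49 / 100)%:E <= e j)%E ->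
    ((w / dist j ^+ 2)%:E <=
      \int[U \x seed_prob alg]_z (wsum (@active R k alg j) (cst 1)
       (state (half true) (half false) (obs_of adv eps istar obs_median) n z))%:E)%E.
  move=> ej.
  have a01 : 0 < 2 * delta <= 1 by lra.
  have thE i : i != j -> raised_median j i = obs_median i.
    by move=> ij; rewrite /raised_median (negbTE ij).
  have he' := hard_err_le n (pac_raised j).
  have lik := @hard_likelihood R adv eps eps_bound k alg istar j j obs_median
    (raised_median j) n (2 * delta) obs_median_bound (raised_median_bound j) thE a01.
  have key := count_bound delta_bound (sqr_ge0 _) (raise_le j)
    (exprn_gt0 2 (dist_gt0 j)) ej he' _ lik.
  apply: key.
  apply: integral_ge0 => z _; rewrite lee_fin; apply: sumr_ge0 => t _.
  by rewrite mulr1 active_ge0.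
(* Two arms with error mass below 49/100 would together fall short of the stopped mass 49/50, so
   there is at most one; if there is none, any arm serves as [j0]. *)
have [j0 hj0] : exists j0, forall j, j != j0 -> ((49 / 100)%:E <= e j)%E.
  have [[j0 hj0]|hall] := pselect (exists j0, ~ ((49 / 100)%:E <= e j0)%E); last first.
    exists istar => j _; apply: contrapT => h; apply: hall; by exists j.
  exists j0 => j jj0; rewrite leNgt; apply/negP => hj.
  move/negP: hj0; rewrite -ltNge => hj0.
  have := hard_err_pair adv eps alg istar obs_median n jj0.
  rewrite leNgt => /negP; apply; apply: lt_le_trans hn.
  have -> : ((1 - 1 / 50)%:E = (49 / 100)%:E + (49 / 100)%:E :> \bar R)%E.
    by rewrite -EFinD; congr EFin; field.
  exact: lteD.
apply: le_trans (hard_expected adv eps alg istar obs_median n j0).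
apply: (@le_trans _ _ (\sum_(j | j != j0) (w / dist j ^+ 2)%:E)%E); last first.
  by apply: lee_sum => j jj0; apply: bound; exact: hj0.
rewrite sumEFin lee_fin.
(* Excluding [j0] instead of [istar] costs nothing: [dist istar = alpha] is the least distance, so
   the term of [istar] replaces that of [j0]. *)
pose v j := w / dist j ^+ 2.
have vle : v j0 <= v istar.
  apply: ler_wpM2l => //.
  rewrite lef_pV2 ?posrE ?exprn_gt0 ?dist_gt0//.
  rewrite lerXn2r ?nnegrE ?(ltW (dist_gt0 _))//.
  have -> : dist istar = alpha by rewrite /dist eqxx.
  exact: dist_ge.
rewrite (_ : 1 / 1800 * _ = \sum_(i | i != istar) v i); last first.
  rewrite mulr_sumr; apply: eq_bigr => i ii; rewrite /v /dist (negbTE ii) /w.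
  by rewrite mul1r mulrCA mulrC; congr (_ * _); exact: mulrC.
have E : v istar + \sum_(i | i != istar) v i = v j0 + \sum_(i | i != j0) v i.
  transitivity (\sum_i v i); last by rewrite (bigD1 j0).
  by rewrite [RHS](bigD1 istar).
by rewrite -(lerD2l (v istar)) E lerD2r.
Qed.

End pac_bound.

Theorem theorem16 (R : realType) :
  exists B c : R, 0 < B /\ 0 < c /\
  forall (adv : adversary) (k : nat) (delta alpha eps tbar : R)
         (istar : 'I_k) (gap : 'I_k -> R),
    (2 <= k)%N ->
    0 < delta < 3 / 20 ->
    0 < alpha < 1 / 6 ->
    0 < eps < 1 / 15 ->
    0 < tbar < 1 / 10 ->
    (forall i : 'I_k, i != istar -> 0 < gap i < 1 / 3) ->
    exists I : cbai_instance R k,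
      [/\ admissible adv eps tbar B I,
          optimal_arm I istar,
          forall i : 'I_k, i != istar ->
            effective_gap adv eps B I istar i = gap i &
          forall alg : algorithm R k,
            PAC adv eps tbar B alpha delta alg ->
            ((c * (\sum_(i < k | i != istar) (Num.max (gap i) alpha ^+ 2)^-1
                   * ln (delta^-1)))%:E
             <= expected_sample_complexity alg I)%E].
Proof.
(* The factor 1/1800 combines 1/200 from [ln_bound] with 1/9 from [raise_le]. *)
exists 4, (1 / 1800); split; first by rewrite ltr0n.
split; first by apply: divr_gt0; [exact: ltr01|rewrite ltr0n].
move=> adv k delta alpha eps tbar istar gap _ hd ha he ht hg.
have thb := obs_median_bound hg.
exists (hard_instance adv eps istar (obs_median istar gap)); split.
- exact: admissible_hard.
- apply: optimal_arm_hard => // i ii.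
  by rewrite /obs_median eqxx (negbTE ii); have := hg _ ii; lra.
- move=> i ii; rewrite effective_gap_hard// /obs_median eqxx (negbTE ii).
  by rewrite sub0r opprK.
- by move=> alg pac; exact: (pac_expected hd ha he ht hg pac).
Qed.
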